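(* Let $K$ be an algebraically closed field of characteristic $p>0$ and let $f(x)\in K[x]$ be a monic polynomial that has at least two distinct roots. Write $\gcd(f)=p^s\gcd_p(f)$ with $p\nmid\gcd_p(f)$, and $f(x)=f_1^{p^s}(x)$ for the unique monic nonscalar polynomial $f_1(x)\in K[x]$. Let $V\ne0$ be a finite dimensional $\mathbb F_p$-subspace of $K$ and let $\mathbb F_{p^e}$ be the multiplier field of $V$. Then the following statements are equivalent: 1. $\widetilde G_f=\mathrm{Sh}_V\ne\{e\}$ and $\overline G_f=\langle\sigma_{\lambda_n,(1-\lambda_n)\nu}\rangle\ne\{e\}$ (for some primitive $n$'th root of unity $\lambda_n\in K$ and some $\nu\in K$). 2. There is a primitive $n$'th root of unity $\lambda_n\ne1$ (in particular, $n\ge2$) such that $\lambda_nV\subseteq V$, and an element $\nu\in K$ such that either $f(x)=f_V^i(x-\nu)$ for some natural number $i\ge1$ and $n=p^e-1$ (in this case, $(p,e)\ne(2,1)$, $\widetilde G_f=\mathrm{Sh}_V$ and $\overline G_f=\langle\sigma_{\lambda_{p^e-1},(1-\lambda_{p^e-1})\nu}\rangle$ where $\mathbb F_{p^e}^\times=\langle\lambda_{p^e-1}\rangle$), or otherwise $f(x)=f_V^i(x-\nu)\,g(f_V^n(x-\nu))$ for some natural number $i\ge0$ and a monic nonscalar polynomial $g(x)\in K[x]$ such that $g(0)\ne0$, and the following two conditions hold: (a) $n\ge2$ and $\gcd\left(\frac{p^e-1}{n},\gcd_p(g)\right)=1$, and (b) $\mathcal R(f)+\mathbb F_p(\lambda_n)(\lambda-\lambda')\not\subseteq\mathcal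 R(f)$ for all distinct roots $\lambda$ and $\lambda'$ of $f$ such that $\lambda-\lambda'\notin V$. Suppose that statement 1 holds. Then the natural number $i$ and the polynomial $g(x)$ in statement 2 are unique, the element $\nu$ is unique up to adding an arbitrary element of $V$ (i.e. $\nu$ can be replaced by $\nu+v$ for any $v\in V$), and the equality $f(x)=f_V^i(x-\nu)g(f_V^n(x-\nu))$ is unique (since $f_V(x-\nu-v)=f_V(x-\nu)$ for all $v\in V$). Furthermore, $\sigma_{\lambda_n,(1-\lambda_n)\nu}(f)=\lambda_n^if$, and $f\in K[x]^{G_f}$ if and only if $n\mid i$. In the second case, i.e. $f(x)=f_V^i(x-\nu)g(f_V^n(x-\nu))$, one has $n=\gcd(p^e-1,\gcd_p(h))$ where $h(x)\in K[x]$ is the unique polynomial such that $f(x)=f_V^i(x-\nu)h(f_V(x-\nu))$ (i.e. $h(x)=g(x^n)$), and either $\nu$ is a root of $f(x)$ (i.e. $i\ge1$) or otherwise (i.e. $i=0$) $\nu$ is a root of the derivative $f_1'(x)$.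
   Context: $\mathrm{Aut}_K(K[x])=\{\sigma_{\lambda,\mu}\mid\lambda\in K^\times,\mu\in K\}$, $\sigma_{\lambda,\mu}(x)=\lambda x+\mu$. The eigengroup of $f$ is $G_f=\{\sigma\in\mathrm{Aut}_K(K[x])\mid\sigma(f)\in K^\times f\}$. Let $\mathrm{Sh}(K)=\{\sigma_{1,\mu}\mid\mu\in K\}$ and, for an $\mathbb F_p$-subspace $V\subseteq K$, $\mathrm{Sh}_V=\{\sigma_{1,v}\mid v\in V\}$. When $f$ has at least two distinct roots, $G_f$ is finite and $G_f=\widetilde G_f\rtimes\overline G_f$, where $\widetilde G_f=G_f\cap\mathrm{Sh}(K)$ and $\overline G_f$ is a (cyclic) complement of the form $\langle\sigma_{\lambda_n,(1-\lambda_n)\nu}\rangle$ with $\lambda_n\in K$ a primitive $n$'th root of unity and $\nu\in K$. For a finite dimensional $\mathbb F_p$-subspace $V$ of $K$: $f_V(x)=\prod_{v\in V}(x-v)$, and $f_V^i(x-\nu):=(f_V(x-\nu))^i$. For $V\neq 0$ the multiplier field of $V$ is the largest finite field $\mathbb F_{p^e}$ (in $K$) such that $\mathbb F_{p^e}V\subseteq V$. For a monic polynomial $f=\sum a_ix^i$ of degree $\ge1$, $\gcd(f):=\gcd\{i\ge1\mid a_i\ne0\}$, and $\gcd(f)=p^s\gcd_p(f)$ with $s\ge0$, $p\nmid\gcd_p(f)$. $\mathcal R(f)$ is the multiset of roots of $f$ counted with multiplicity (inclusions respect multiplicities, i.e. the condition $\mathcal R(f)+W\subseteq\mathcal R(f)$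 means that translation by each element of $W$ maps the multiset $\mathcal R(f)$ into itself). $\mathbb F_p(\lambda_n)(\lambda-\lambda')$ is the set of multiples of $\lambda-\lambda'$ by elements of the field $\mathbb F_p(\lambda_n)$. $K[x]^{G_f}$ is the algebra of $G_f$-invariants. *)

(* Defs.v *)
From HB Require Import structures.
From mathcomp Require Import all_boot all_order all_algebra all_field.
From mathcomp Require Import finmap.
From mathcomp Require Import all_classical.

Set Implicit Arguments.
Unset Strict Implicit.
Unset Printing Implicit Defensive.

Import GRing.Theory.

Local Open Scope ring_scope.
Local Open Scope classical_set_scope.

Section Eigengroup.
Variable K : closedFieldType.
Implicit Types (s t : {poly K} -> {poly K}) (f q : {poly K}) (V : {fset K}).

Definition polyAut : set ({poly K} -> {poly K}) :=
  [set s : {poly K} -> {poly K} | [/\ bijective s, linear s & monoid_morphism s]].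

Definition sigma (a b : K) : {poly K} -> {poly K} :=
  fun q => q \Po (a *: 'X + b%:P).

Lemma polyAutE :
  polyAut = [set s | exists a b : K, a != 0 /\ s = sigma a b].
Proof.
apply/seteqP; split => [s [[t st ts] slin smul]|_ [a [b [a0 ->]]]].
  pose ls := GRing.isLinear.Build K {poly K} {poly K} _ s slin.
  pose ms := GRing.isMonoidMorphism.Build {poly K} {poly K} s smul.
  pose r : {lrmorphism {poly K} -> {poly K}} := HB.pack s ls ms.
  have rE q : s q = q \Po s 'X.
    rewrite -[in LHS](coefK q) poly_def comp_polyE -[s _]/(r _) raddf_sum.
    apply: eq_bigr => i _; rewrite [LHS](linearZ_LR r); congr (_ *: _).
    exact: (rmorphXn r).
  have : size (t 'X \Po s 'X) = 2 by rewrite -rE ts size_polyX.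
  have := size_comp_poly (t 'X) (s 'X); move=> + E; rewrite E => /= H.
  have s2 : size (s 'X) = 2.
    move: (esym H) => /eqP; rewrite muln_eq1 => /andP[_].
    by case: (size _) => [//|[//|[|//]]].
  exists (s 'X)`_1, (s 'X)`_0; split.
    by have := lead_coefE (s 'X); rewrite s2 /= => <-;
       rewrite lead_coef_eq0 -size_poly_eq0 s2.
  apply/funext => q; rewrite rE /sigma; congr (_ \Po _).
  apply/polyP => -[|[|i]]; rewrite !coefE //=.
  - by rewrite mulr0 add0r.
  - by rewrite mulr1 addr0.
  - by rewrite mulr0 addr0 nth_default // s2.
split.
- exists (fun q => q \Po (a^-1 *: 'X + (- (b / a))%:P)) => q;
    rewrite /sigma -comp_polyA comp_polyD comp_polyZ comp_polyX comp_polyC.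
  + rewrite scalerDr scalerA mulfV // scale1r -mul_polyC -polyCM -addrA -polyCD.
    by rewrite mulrN mulrCA mulfV // mulr1 addNr addr0 comp_polyXr.
  + rewrite scalerDr scalerA mulVf // scale1r -mul_polyC -polyCM -addrA -polyCD.
    by rewrite mulrC subrr addr0 comp_polyXr.
- by move=> c u v; rewrite /sigma comp_polyD comp_polyZ.
- by split=> [|u v]; rewrite /sigma ?comp_polyM // -[1]/(1%:P) comp_polyC.
Qed.

Definition cyclicAut t : set ({poly K} -> {poly K}) :=
  [set s | exists k : nat,
     s = iter k t \/ cancel (iter k t) s /\ cancel s (iter k t)].

Definition trivAut : set ({poly K} -> {poly K}) := [set id].

Definition eigengroup f : set ({poly K} -> {poly K}) :=
  [set s | polyAut s /\ exists2 c : K, c != 0 & s f = c *: f].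

Definition Sh : set ({poly K} -> {poly K}) :=
  [set s | exists m : K, s = sigma 1 m].

Definition ShV V : set ({poly K} -> {poly K}) :=
  [set s | exists2 v : K, v \in V & s = sigma 1 v].

Definition eigengroup_shift f := eigengroup f `&` Sh.

Definition is_semidirect (G N H : set ({poly K} -> {poly K})) : Prop :=
  [/\ forall s, G s -> [set s \o t | t in N] = [set t \o s | t in N],
      G = [set s \o t | s in N & t in H]
    & N `&` H = trivAut].

(* The complement of the shift part of an eigengroup is determined only up to
   conjugacy, so an equality of the complement with [H] means that
   [H] is a complement. *)
Definition is_eigengroup_complement f (H : set ({poly K} -> {poly K})) : Prop :=
  is_semidirect (eigengroup f) (eigengroup_shift f) H.

Definition eigengroup_invariants f : set {poly K} :=
  [set q | forall s, eigengroup f s -> s q = q].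

(* Over the finite field F_p, the finite dimensional subspaces are the finite
   ones; [pPrimeCharType chp] is K with its canonical F_p-module structure. *)
Definition Fp_subspace p (chp : p \in [pchar K]) V : Prop :=
  GRing.submod_closed ([pred x | x \in V] : {pred pPrimeCharType chp}).

Definition fV V : {poly K} := \prod_(v <- V) ('X - v%:P).

(* f_V(x - nu) *)
Definition fV_at V (nu : K) : {poly K} := fV V \Po ('X - nu%:P).

Definition stabilizes (F : {pred K}) V : Prop :=
  forall a v, a \in F -> v \in V -> a * v \in V.

(* The subfield of order q of K, for q a power of the characteristic. *)
Definition Fq (q : nat) : {pred K} := [pred a | a ^+ q == a].

Definition is_multiplier_field (p : nat) V (e : nat) : Prop :=
  [/\ (0 < e)%N, stabilizes (Fq (p ^ e)) V
    & forall e', (0 < e')%N -> stabilizes (Fq (p ^ e')) V ->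
        {subset Fq (p ^ e') <= Fq (p ^ e)}].

(* The least subfield of K containing l; it contains the prime field. *)
Definition Fp_adjoin (l : K) : set K :=
  [set a | forall S : {pred K}, GRing.divring_closed S -> l \in S -> a \in S].

Definition gcd_exp f : nat :=
  \big[gcdn/0%N]_(1 <= i < size f | f`_i != 0) i.

Definition gcd_exp_p (p : nat) f : nat := ((gcd_exp f)`_p^')%N.

(* The multiset of roots R(f) is the multiplicity function [mup ^~ f]; that of
   the translate R(f) + w at a + w is [mup a f]. *)
Definition roots_stable f (W : set K) : Prop :=
  forall w, W w -> forall a, (mup a f <= mup (a + w) f)%N.

Definition statement1_at f V (n : nat) (l nu : K) : Prop :=
  [/\ eigengroup_shift f = ShV V, ShV V <> trivAut, n.-primitive_root l,
      is_eigengroup_complement f (cyclicAut (sigma l ((1 - l) * nu)))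
    & cyclicAut (sigma l ((1 - l) * nu)) <> trivAut].

Definition statement1 f V : Prop :=
  exists (n : nat) (l nu : K), statement1_at f V n l nu.

Definition root_data V (n : nat) (l : K) : Prop :=
  [/\ n.-primitive_root l, l != 1 & forall v, v \in V -> l * v \in V].

Definition first_case (p e : nat) f V (n : nat) (nu : K) (i : nat) : Prop :=
  [/\ (1 <= i)%N, f = fV_at V nu ^+ i & n = (p ^ e).-1].

Definition second_case (p e : nat) f V (n : nat) (l nu : K)
    (i : nat) (g : {poly K}) : Prop :=
  [/\ f = fV_at V nu ^+ i * (g \Po (fV_at V nu ^+ n)),
      g \is monic, (1 < size g)%N & g.[0] != 0] /\
  [/\ (2 <= n)%N, gcdn ((p ^ e).-1 %/ n) (gcd_exp_p p g) = 1%N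
    & forall a b : K, root f a -> root f b -> a != b -> a - b \notin V ->
        ~ roots_stable f [set c * (a - b) | c in Fp_adjoin l]].

Definition statement2_at (p e : nat) f V (n : nat) (l nu : K) : Prop :=
  root_data V n l /\
  ((exists i, first_case p e f V n nu i) \/
   (exists i g, second_case p e f V n l nu i g)).

Definition statement2 (p e : nat) f V : Prop :=
  exists (n : nat) (l nu : K), statement2_at p e f V n l nu.

End Eigengroup.

(* Main.v *)
(* Identify [sigma a b] with the affine map [x -> a x + b]: it is in the
   eigengroup of [f] iff it preserves the multiset of roots of [f].  Invariance under the
   translations by [V] means [f = h(f_V(x - nu))], and since
   [f_V(l x) = l f_V(x)] when [l V <= V], invariance under the rotation by [l]
   about [nu] means [h = x^i g(x^n)] with [g(0) != 0].  Two eigen-maps with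
   linear parts [a] and [l] have composites differing by a translation, so once the
   translations are exactly [Sh_V], every linear part [a] is also the linear
   part of a rotation about [nu]; it lies in F_{p^e}, and [a^n] fixes [g].  Hence the
   linear parts reduce to [<l>] exactly when no [k > 1] divides both
   [(p^e - 1) / n] and all exponents of [g]; for [g = 1] this says
   [n = p^e - 1], which is the first case. *)
Require Import Defs.
From mathcomp Require Import all_boot all_order all_algebra all_field.
From mathcomp Require Import cyclic.
From mathcomp Require Import finmap.
From mathcomp Require Import all_classical.
From mathcomp Require Import ring.

Set Implicit Arguments.
Unset Strict Implicit.
Unset Printing Implicit Defensive.

Import GRing.Theory.

Local Open Scope ring_scope.
Local Open Scope classical_set_scope.

(** * Affine substitutions, eigen-maps and translation periods of a polynomial *)

Section AffineSubstitution.
Variable K : closedFieldType.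
Implicit Types (f g h q : {poly K}) (a b c l nu v w : K).

Definition aff a b : {poly K} := a *: 'X + b%:P.

Lemma comp_aff a b c d : aff a b \Po aff c d = aff (a * c) (a * d + b).
Proof.
rewrite /aff comp_polyD comp_polyZ comp_polyX comp_polyC.
by rewrite scalerDr scalerA -addrA -[a *: d%:P]mul_polyC -polyCM polyCD.
Qed.

Lemma aff1 : aff 1 0 = 'X.
Proof. by rewrite /aff scale1r addr0. Qed.

Lemma aff_inj a b c d : aff a b = aff c d -> a = c /\ b = d.
Proof.
move=> /polyP E; split; [move: (E 1%N)|move: (E 0%N)];
  by rewrite !coefE /= ?mulr1 ?addr0 ?mulr0 ?add0r.
Qed.

Lemma size_aff a b : a != 0 -> size (aff a b) = 2.
Proof.
move=> a0; rewrite size_polyDl size_scale ?size_polyX //.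
by rewrite (leq_ltn_trans (size_polyC_leq1 _)).
Qed.

Lemma comp_polyI f g q : (1 < size q)%N -> f \Po q = g \Po q -> f = g.
Proof.
move=> sq /eqP; rewrite -subr_eq0 -comp_polyB comp_poly_eq0 // subr_eq0.
by move/eqP.
Qed.

(** Membership of [sigma a b] in the eigengroup of [f] (see [eigengroup_sigma]), phrased on
    coefficients to avoid equalities between functions. *)
Definition eig f a b : Prop :=
  a != 0 /\ exists2 c, c != 0 & f \Po aff a b = c *: f.

Definition period f w : Prop := f \Po aff 1 w = f.

(** Comparing leading coefficients determines the multiplier. *)
Lemma eig_exp f a b : f \is monic -> eig f a b ->
  f \Po aff a b = a ^+ (size f).-1 *: f.
Proof.
move=> fm [a0 [c c0 E]]; rewrite E; congr (_ *: _).
have := congr1 lead_coef E; rewrite lead_coef_comp ?size_aff // lead_coefZ.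
rewrite (monicP fm) mulr1 mul1r [lead_coef _]lead_coefE size_aff // /aff.
by rewrite !coefE /= mulr1 addr0 => ->.
Qed.

Lemma eig1 f w : f \is monic -> eig f 1 w <-> period f w.
Proof.
move=> fm; split=> [/(eig_exp fm)|E]; first by rewrite expr1n scale1r.
by split; [exact: oner_neq0|exists 1; rewrite ?oner_neq0 // scale1r].
Qed.

Lemma eigM f a b c d : eig f a b -> eig f c d -> eig f (a * c) (a * d + b).
Proof.
move=> [a0 [x x0 E]] [c0 [y y0 F]]; split; first by rewrite mulf_neq0.
exists (x * y); first by rewrite mulf_neq0.
by rewrite -comp_aff comp_polyA E comp_polyZ F scalerA.
Qed.

(** Translating by [a w] after the map [a x + b] is the same as translating by [w] before it, so the
    linear part of an eigen-map acts on the periods, in both directions. *)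
Lemma period_eig f a b w : f \is monic -> eig f a b ->
  period f (a * w) <-> period f w.
Proof.
move=> fm E; have [a0 _] := E; have Ef := eig_exp fm E.
have C : aff 1 (a * w) \Po aff a b = aff a b \Po aff 1 w.
  by rewrite !comp_aff mul1r mulr1 addrC mul1r.
have {}C : (f \Po aff 1 (a * w)) \Po aff a b
         = a ^+ (size f).-1 *: (f \Po aff 1 w).
  by rewrite -comp_polyA C comp_polyA Ef comp_polyZ.
rewrite /period; split=> P.
  by apply: (scalerI (expf_neq0 (size f).-1 a0)); rewrite -C P Ef.
by apply: (@comp_polyI _ _ (aff a b)); rewrite ?size_aff // C P Ef.
Qed.

(** Translating by [(b - b') / a] and then applying [a x + b'] gives [a x + b]; hence [(b - b') / a]
    is a period, and [period_eig] multiplies it by [a]. *)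
Lemma period_diff f a b b' : f \is monic ->
  eig f a b -> eig f a b' -> period f (b - b').
Proof.
move=> fm Eb Eb'; have [a0 _] := Eb.
rewrite -[b - b'](mulfVK a0) mulrC.
apply/(period_eig _ fm Eb'); apply: (scalerI (expf_neq0 (size f).-1 a0)).
rewrite -comp_polyZ -(eig_exp fm Eb') -comp_polyA comp_aff mulr1.
by rewrite mulrC mulfVK // subrK (eig_exp fm Eb) (eig_exp fm Eb').
Qed.

Lemma eig_period f a b w : f \is monic ->
  eig f a b -> period f w -> eig f a (b + w).
Proof.
by move=> fm E /(eig1 _ fm)/eigM/(_ E); rewrite mul1r mul1r.
Qed.

Lemma periodD f w w' : period f w -> period f w' -> period f (w + w').
Proof.
rewrite /period => E E'.
by rewrite -{2}E' -{2}E -comp_polyA comp_aff !mul1r addrC.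
Qed.

Lemma period0 f : period f 0.
Proof. by rewrite /period aff1 comp_polyXr. Qed.

Lemma periodN f w : period f w -> period f (- w).
Proof.
rewrite /period => E.
by rewrite -{1}E -comp_polyA comp_aff !mul1r addrC subrr aff1 comp_polyXr.
Qed.

(** The constant term [(1 - a) * nu] makes [nu] a fixed point of the affine map of slope [a]; powers
    keep that fixed point. *)
Lemma eig_iter f a nu k : eig f a ((1 - a) * nu) ->
  eig f (a ^+ k) ((1 - a ^+ k) * nu).
Proof.
move=> E; elim: k => [|k IH].
  rewrite expr0 subrr mul0r; split; first exact: oner_neq0.
  by exists 1; rewrite ?oner_neq0 // scale1r; exact: period0.
have := eigM E IH; rewrite -exprS; congr eig.
by rewrite exprS; ring.
Qed.

Lemma root_period f a w : period f w -> root f a -> root f (a + w).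
Proof.
move=> P; by rewrite -{1}P /root horner_comp /aff !hornerE.
Qed.

Lemma sigmaE a b q : sigma a b q = q \Po aff a b.
Proof. by []. Qed.

(** Substitution is contravariant: the underlying affine maps compose in the opposite order. *)
Lemma sigma_comp a b c d : sigma a b \o sigma c d = sigma (c * a) (c * b + d).
Proof. by apply/funext => q; rewrite /= !sigmaE -comp_polyA comp_aff. Qed.

Lemma sigma_inj a b c d : sigma a b = sigma c d -> a = c /\ b = d.
Proof.
by move/(congr1 (fun s => s 'X)); rewrite /= !sigmaE !comp_polyX => /aff_inj.
Qed.

Lemma sigma1 : sigma 1 0 = id :> ({poly K} -> {poly K}).
Proof. by apply/funext => q; rewrite sigmaE aff1 comp_polyXr. Qed.

Lemma eigengroupP f s :
  eigengroup f s <-> exists2 ab, s = sigma ab.1 ab.2 & eig f ab.1 ab.2.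
Proof.
rewrite /eigengroup /= polyAutE; split.
  by move=> [[a [b [a0 ->]]] E]; exists (a, b).
by move=> [[a b] /= -> [a0 E]]; split => //; exists a, b.
Qed.

Lemma eigengroup_sigma f a b : eigengroup f (sigma a b) <-> eig f a b.
Proof.
rewrite eigengroupP; split=> [[[c d] /= E]|E]; last by exists (a, b).
by have [-> ->] := sigma_inj E.
Qed.

Lemma eigengroup_shift_sigma f s : f \is monic ->
  eigengroup_shift f s <-> exists2 w, s = sigma 1 w & period f w.
Proof.
move=> fm; split=> [[G [w E]]|[w -> P]].
  by exists w; rewrite // -eig1 // -eigengroup_sigma -E.
by split; [apply/eigengroup_sigma/eig1|exists w].
Qed.

Lemma iter_sigma l nu k :
  iter k (sigma l ((1 - l) * nu)) = sigma (l ^+ k) ((1 - l ^+ k) * nu).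
Proof.
elim: k => [|k IH]; first by rewrite expr0 subrr mul0r sigma1.
have -> : iter k.+1 (sigma l ((1 - l) * nu))
   = sigma l ((1 - l) * nu) \o iter k (sigma l ((1 - l) * nu)) by [].
rewrite IH sigma_comp -exprSr; congr sigma.
by rewrite exprS; ring.
Qed.

Lemma prim_root_neq0 n l : n.-primitive_root l -> l != 0.
Proof.
move=> pl; apply: contraTneq (oner_neq0 K) => l0.
by rewrite -(prim_expr_order pl) l0 expr0n gtn_eqF ?(prim_order_gt0 pl) ?eqxx.
Qed.

Lemma cyclicAutP n l nu s : n.-primitive_root l ->
  cyclicAut (sigma l ((1 - l) * nu)) s <->
  exists k, s = sigma (l ^+ k) ((1 - l ^+ k) * nu).
Proof.
move=> pl; rewrite /cyclicAut /=; split=> [[k]|[k ->]]; last first.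
  by exists k; left; rewrite iter_sigma.
rewrite iter_sigma => -[->|[C1 C2]]; first by exists k.
(* As [l ^+ n = 1], the inverse of [l ^+ k] is its power of exponent [n - 1], so inverses are again
   nonnegative powers. *)
exists (k * n.-1)%N; apply/funext => q.
set t := sigma _ _.
rewrite -[in LHS](_ : (sigma (l ^+ k) ((1 - l ^+ k) * nu) \o t) q = q) ?C1 //.
rewrite sigma_comp -exprD -mulnSr prednK ?(prim_order_gt0 pl) //.
have E : l ^+ (k * n) = 1 by rewrite mulnC exprM (prim_expr_order pl) expr1n.
rewrite E mulrA -mulrDl mulrBr mulr1 -exprD -mulnSr.
rewrite prednK ?(prim_order_gt0 pl) // E addrC addrA subrK subrr mul0r.
by rewrite sigma1.
Qed.

End AffineSubstitution.

(** * Finite subfields of [K] and the multipliers of a finite [F_p]-subspace *)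

Section MultiplierField.
Variable K : closedFieldType.
Variable p : nat.
Hypothesis chp : p \in [pchar K].
Implicit Types (a v w : K) (s : seq K) (V : {fset K}).

Lemma pchar_pow_nat k : [pchar K].-nat (p ^ k)%N.
Proof. by rewrite pnatX pnatE ?chp // (pcharf_prime chp). Qed.

Lemma exprD_pow k a b : (a + b) ^+ (p ^ k) = a ^+ (p ^ k) + b ^+ (p ^ k).
Proof. exact/exprDn_pchar/pchar_pow_nat. Qed.

Lemma exprB_pow k a b : (a - b) ^+ (p ^ k) = a ^+ (p ^ k) - b ^+ (p ^ k).
Proof. by apply/eqP; rewrite eq_sym subr_eq -exprD_pow subrK. Qed.

Lemma Fq1 k : (1 : K) \in Fq (p ^ k).
Proof. by rewrite unfold_in expr1n. Qed.

Lemma FqB k a b : a \in Fq (p ^ k) -> b \in Fq (p ^ k) -> a - b \in Fq (p ^ k).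
Proof. by rewrite !unfold_in exprB_pow => /eqP-> /eqP->. Qed.

Lemma FqV k a : a \in Fq (p ^ k) -> a^-1 \in Fq (p ^ k).
Proof. by rewrite !unfold_in exprVn => /eqP->. Qed.

Lemma FqM k a b : a \in Fq (p ^ k) -> b \in Fq (p ^ k) -> a * b \in Fq (p ^ k).
Proof. by rewrite !unfold_in exprMn => /eqP-> /eqP->. Qed.

Lemma Fq_expr1 k a : a \in Fq (p ^ k) -> a != 0 -> a ^+ (p ^ k).-1 = 1.
Proof.
rewrite unfold_in => /eqP E a0; apply: (mulfI a0).
by rewrite mulr1 -exprS prednK // expn_gt0 prime_gt0 // (pcharf_prime chp).
Qed.

(** Multiplication by [a] is injective and maps the finite set [s] into itself, so it permutes the
    roots; each factor then contributes one [a]. *)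
Lemma prod_XsubC_scale s a : uniq s -> a != 0 ->
  {in s, forall v, a * v \in s} ->
  (\prod_(v <- s) ('X - v%:P)) \Po aff a 0
    = a ^+ size s *: \prod_(v <- s) ('X - v%:P).
Proof.
move=> us a0 as_.
have ua : uniq [seq a * v | v <- s] by rewrite map_inj_uniq //; exact: mulfI.
have sub : {subset [seq a * v | v <- s] <= s}.
  by move=> _ /mapP[v vs ->]; exact: as_.
have [|_ P] := uniq_min_size ua sub; first by rewrite size_map.
have {P}P : perm_eq s [seq a * v | v <- s].
  by apply: uniq_perm => // x; rewrite P.
rewrite [in LHS](perm_big _ P) big_map /= rmorph_prod /=.
under eq_bigr => v _.
  rewrite comp_polyB comp_polyX comp_polyC /aff addr0 polyCM mul_polyC.
  rewrite -scalerBr -mul_polyC; over.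
rewrite big_split /= big_const_seq count_predT iter_mulr_1 -polyC_exp.
by rewrite mul_polyC.
Qed.

(* The linear coefficient of [\prod_(v <- s) ('X - v%:P)] is nonzero, as [0] is
   a simple root; comparing it on both sides of [prod_XsubC_scale] gives the
   claim. *)
Lemma expr_size_stable s a : uniq s -> 0 \in s ->
  {in s, forall v, a * v \in s} -> a ^+ size s = a.
Proof.
move=> us s0 as_; have [->|a0] := eqVneq a 0.
  by rewrite expr0n; case: s s0 {us as_}.
have := prod_XsubC_scale us a0 as_.
rewrite (perm_big _ (perm_to_rem s0)) big_cons /= subr0.
set r := \prod_(v <- _) _ => E.
have r0 : r.[0] != 0.
  by rewrite -[_ == 0]/(root r 0) root_prod_XsubC mem_rem_uniq // inE eqxx.
move: E; rewrite comp_polyM comp_polyX {1}/aff addr0 -scalerAl scalerAr.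
rewrite [RHS]scalerAr => /(mulfI (negbT (polyX_eq0 _)))/(congr1 (horner^~ 0)).
rewrite !hornerZ horner_comp /aff !hornerE => /(mulIf r0).
by [].
Qed.

(** Factoring the difference of the two powers through [('X + 1) - 'X = 1] leaves a sum of terms of
    degree [N]. A nonzero polynomial of this size cannot have [N.+1] distinct roots. *)
Lemma size_sub_expr N :
  (size (('X + 1 : {poly K}) ^+ N.+1 - 'X^(N.+1) - 1)%R <= N.+1)%N.
Proof.
rewrite addrC (leq_trans (size_polyD _ _)) // geq_max size_polyN size_poly1 /=.
rewrite subrXX addrAC subrr add0r mul1r.
apply: (leq_trans (size_sum _ _ _)); apply/bigmax_leqP => i _.
have X1 : 'X + 1 != 0 :> {poly K} by rewrite -size_poly_gt0 -polyC1 size_XaddC.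
rewrite size_mulXn ?expf_neq0 // addnC -ltnS.
rewrite (polySpred (expf_neq0 _ X1)) size_exp -polyC1 size_XaddC mul1n.
by rewrite addSn subnK // -ltnS.
Qed.

(** On [s] the power map of exponent [size s] is the identity, hence additive along [x + 1]. So
    [(x + 1)^N - x^N - 1], with [N = size s], has [N] roots but degree below [N], and vanishes
    identically; this forces [N] to be a power of [p]. *)
Lemma size_expr_fix s : uniq s -> 0 \in s -> 1 \in s ->
  {in s &, forall a b, a + b \in s} -> {in s, forall a, a ^+ size s = a} ->
  exists2 k, (0 < k)%N & size s = (p ^ k)%N.
Proof.
move=> us s0 s1 sD sX.
have sz1 : (1 < size s)%N.
  rewrite (@uniq_leq_size _ [:: 0; 1]) //= ?inE 1?eq_sym ?oner_neq0 //.
  by move=> x; rewrite !inE => /orP[] /eqP->.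
case Es : (size s) sX => [|N] sX; first by rewrite Es in sz1.
set D : {poly K} := ('X + 1) ^+ N.+1 - 'X^(N.+1) - 1.
have RD : all (root D) s.
  apply/allP => x xs; rewrite /root /D !hornerE !sX ?sD //.
  by apply/eqP; ring.
have {RD} D0 : D = 0.
  apply/eqP/negPn/negP => nz; have := max_poly_roots nz RD us.
  by rewrite Es ltnNge size_sub_expr.
have prp := pcharf_prime chp.
have [r cr Er] := pfactor_coprime prp (ltn0Sn N).
set P := (p ^ logn p N.+1)%N in Er.
have Pgt0 : (0 < P)%N by rewrite expn_gt0 prime_gt0.
(* Extracting the Frobenius power [P] leaves [(x + 1)^r - x^r - 1 = 0]; if [r > 1], its derivative
   at [0] is [r], which is nonzero in [K]. *)
have r1 : r = 1%N.
  have pP : [pchar {poly K}].-nat P.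
    by rewrite (eq_pnat _ (pchar_poly K)) pchar_pow_nat.
  have : (('X + 1) ^+ r - 'X^r - 1 : {poly K}) \Po 'X^P = 0.
    rewrite -D0 /D Er mulnC !exprM !comp_polyB !comp_Xn_poly !rmorphXn /=.
    rewrite comp_polyD comp_polyX -[1 \Po _]/(1%:P \Po _) comp_polyC.
    by rewrite (exprDn_pchar _ _ pP) expr1n.
  move/eqP; rewrite comp_poly_eq0 ?size_polyXn // => /eqP.
  move/(congr1 (fun q => (deriv q).[0])).
  rewrite !derivB derivXn deriv_exp derivD derivX -polyC1 derivC deriv0.
  rewrite !hornerE !hornerMn !hornerE expr1n.
  move: cr; rewrite prime_coprime // (dvdn_pcharf chp).
  case: r Er => [|[|r]] //= _.
  by rewrite exprS mul0r mul0rn !subr0 => /eqP nr /nr.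
exists (logn p N.+1); rewrite -/P ?[LHS]Er ?r1 ?mul1n //.
rewrite lt0n; apply: contraTneq sz1 => /= E; rewrite Es.
by rewrite [N.+1]Er r1 /P E expn0.
Qed.

(** All multipliers of [V] form a finite set closed under sums and products; it has [p ^ k] elements
    and coincides with [Fq (p ^ k)], so maximality of [e] applies to it. *)
Lemma multiplier_Fq V e a :
  Fp_subspace chp V -> (exists2 v, v \in V & v != 0) ->
  is_multiplier_field p V e -> (forall v, v \in V -> a * v \in V) ->
  a \in Fq (p ^ e).
Proof.
move=> [V0 VL] [v0 v0V v00] [_ _ emax] aV.
pose t := fun b => all (fun w => b * w \in V) V.
(* A multiplier [b] is determined by [b * v0], an element of [V]; this makes the list of multipliers
   finite. *)
pose s := undup [seq b <- [seq v / v0 | v <- V] | t b].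
have sP b : reflect (forall v, v \in V -> b * v \in V) (b \in s).
  rewrite mem_undup mem_filter; apply: (iffP andP) => [[/allP h _]//|h].
  split; first exact/allP.
  by apply/mapP; exists (b * v0); [exact: h|rewrite mulfK].
have VD u v : u \in V -> v \in V -> u + v \in V.
  by move=> uV vV; have := VL 1 u v uV vV; rewrite scale1r.
have us : uniq s := undup_uniq _.
have s0 : 0 \in s by apply/sP => v _; rewrite mul0r.
have s1 : 1 \in s by apply/sP => v; rewrite mul1r.
have sD : {in s &, forall a b, a + b \in s}.
  move=> b c /sP hb /sP hc; apply/sP => v vV; rewrite mulrDl.
  by rewrite VD ?hb ?hc.
have sM : {in s &, forall a b, a * b \in s}.
  move=> b c /sP hb /sP hc; apply/sP => v vV; rewrite -mulrA.
  by rewrite hb ?hc.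
have sX : {in s, forall a, a ^+ size s = a}.
  by move=> b bs; apply: expr_size_stable => // c cs; exact: sM.
have [k k0 sk] := size_expr_fix us s0 s1 sD sX.
(* The [p ^ k] elements of [s] already exhaust the roots of ['X^(p ^ k) - 'X]. *)
have sF : Fq (p ^ k) =i s.
  have sub : {subset s <= Fq (p ^ k)}.
    by move=> b bs; rewrite unfold_in -sk; apply/eqP/sX.
  move=> b; apply/idP/idP => [bF|]; last exact: sub.
  apply/negPn/negP => bs.
  have Pgt1 : (1 < p ^ k)%N.
    by rewrite -[1%N](expn0 p) ltn_exp2l // prime_gt1 // (pcharf_prime chp).
  have D0 : 'X^(p ^ k) - 'X != 0 :> {poly K}.
    by rewrite -size_poly_gt0 size_polyDl ?size_polyXn // size_polyN size_polyX.
  have R : all (root ('X^(p ^ k) - 'X)) (b :: s).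
    apply/allP => c cs; rewrite /root !hornerE subr_eq0.
    by move: cs; rewrite inE => /predU1P[->//|/sub].
  have := max_poly_roots D0 R; rewrite size_polyDl ?size_polyXn ?size_polyN.
    by rewrite /= bs us sk ltnn => /(_ isT).
  by rewrite size_polyX.
apply: (emax k k0); last by rewrite sF; exact/sP.
by move=> b v; rewrite sF => /sP; apply.
Qed.
End MultiplierField.

(** * Translations and multiplicities of roots *)

Section RootMultiplicities.
Variable K : closedFieldType.
Implicit Types (f : {poly K}) (a w : K) (r : seq K).

Lemma prod_XsubC_shift r w :
  (\prod_(z <- r) ('X - z%:P)) \Po aff 1 w
    = \prod_(z <- [seq z - w | z <- r]) ('X - z%:P).
Proof.
rewrite big_map rmorph_prod /=; apply: eq_bigr => z _.
rewrite comp_polyB comp_polyX comp_polyC /aff scale1r polyCB opprB addrA.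
by rewrite addrAC.
Qed.

Lemma monic_splits f : f \is monic ->
  exists r, f = \prod_(z <- r) ('X - z%:P).
Proof.
move=> fm; have [r E] := closed_field_poly_normal f; exists r.
by rewrite E (monicP fm) scale1r.
Qed.

Lemma mup_shift f a w : f \is monic ->
  mup a (f \Po aff 1 w) = mup (a + w) f.
Proof.
move=> /monic_splits[r ->]; rewrite prod_XsubC_shift !mu_prod_XsubC.
by rewrite count_map; apply: eq_count => z /=; rewrite subr_eq.
Qed.

(** A monic polynomial over [K] is determined by its root multiplicities, and substituting [x + w]
    shifts them. *)
Lemma period_mupP f w : f \is monic ->
  period f w <-> forall a, mup a f = mup (a + w) f.
Proof.
move=> fm; split=> [E a|E]; first by rewrite -{1}E mup_shift.
have [r Er] := monic_splits fm.
rewrite /period Er prod_XsubC_shift; apply: perm_big.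
rewrite /perm_eq; apply/allP => a _ /=.
rewrite -!mu_prod_XsubC -prod_XsubC_shift -Er.
by rewrite (mup_shift a w fm) -E.
Qed.

(** Since [p w = 0], the remaining [p - 1] translations lead from [a + w] back to [a], so the
    inequalities close up into a cycle. Thus inclusion of root multisets amounts to equality. *)
Lemma translate_leq_eq p (m : K -> nat) w : p \in [pchar K] ->
  (forall a, m a <= m (a + w)%R)%N -> forall a, m a = m (a + w).
Proof.
move=> chp le a; apply/eqP; rewrite eqn_leq le /=.
have H k b : (m b <= m (b + w *+ k)%R)%N.
  elim: k => [|k IH]; first by rewrite mulr0n addr0.
  by rewrite mulrSr addrA (leq_trans IH).
have := H p.-1 (a + w).
rewrite -addrA -mulrS prednK ?prime_gt0 ?(pcharf_prime chp) //.
by rewrite mulrn_pchar // addr0.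
Qed.

Lemma stable_period p f w : p \in [pchar K] -> f \is monic ->
  (forall a, mup a f <= mup (a + w)%R f)%N -> period f w.
Proof.
move=> chp fm le; apply: (period_mupP w fm).2.
exact: (translate_leq_eq chp le).
Qed.

End RootMultiplicities.

(** * Greatest common divisors of exponents and polynomials in [x^n] *)

Section ExponentGcd.
Variable R : closedFieldType.
Implicit Types (f g h : {poly R}).

(** Every [m] divides [0], so [j] may range over all exponents although [gcd_exp] starts at [1]. *)
Lemma dvdn_gcd_exp f m :
  (m %| gcd_exp f)%N <-> forall j, f`_j != 0 -> (m %| j)%N.
Proof.
rewrite /gcd_exp big_add1 big_mkord; split=> [|H].
  move=> /dvdn_biggcdP H [|j] fj; first exact: dvdn0.
  have js : (j < (size f).-1)%N.
    have : (j.+1 < size f)%N.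
      by rewrite ltnNge; apply: contra fj => /leq_sizeP->.
    by case: (size f).
  exact: (H (Ordinal js)).
by apply/dvdn_biggcdP => i; exact: H.
Qed.

Lemma gcd_exp_gt0 f : (1 < size f)%N -> (0 < gcd_exp f)%N.
Proof.
move=> sf; have := (dvdn_gcd_exp f (gcd_exp f)).1 (dvdnn _) (size f).-1.
rewrite -lead_coefE lead_coef_eq0 -size_poly_gt0 (ltn_trans _ sf) //.
move=> /(_ isT).
rewrite lt0n; apply: contraTneq => ->; rewrite dvd0n.
by case: (size f) sf => [|[]].
Qed.

Lemma comp_Xn_decomp f n : (0 < n)%N -> (forall j, f`_j != 0 -> (n %| j)%N) ->
  f = (\poly_(k < size f) f`_(n * k)) \Po 'X^n.
Proof.
move=> n0 H; apply/polyP => j; rewrite coef_comp_poly_Xn // coef_poly.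
case: ifPn => [nj|/negP nj]; last by have [//|/H] := eqVneq f`_j 0.
rewrite mulnC divnK //; case: ltnP => // sj; apply: nth_default.
by rewrite (leq_trans sj) // leq_div.
Qed.

Lemma gcd_exp_comp_Xn g n : (0 < n)%N ->
  gcd_exp (g \Po 'X^n) = (n * gcd_exp g)%N.
Proof.
move=> n0; apply/eqP; rewrite eqn_dvd; apply/andP; split.
  have : (n %| gcd_exp (g \Po 'X^n))%N.
    apply/dvdn_gcd_exp => j; rewrite coef_comp_poly_Xn //.
    by case: ifP => //; rewrite eqxx.
  move=> /dvdnP[m Em]; rewrite Em mulnC dvdn_pmul2l //.
  apply/dvdn_gcd_exp => j gj; rewrite -(dvdn_pmul2l n0) mulnC -Em.
  apply: (dvdn_gcd_exp _ _).1 (dvdnn _) _ _.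
  by rewrite coef_comp_poly_Xn // dvdn_mulr // mulKn.
apply/dvdn_gcd_exp => j; rewrite coef_comp_poly_Xn //.
case: ifP; rewrite ?eqxx // => /dvdnP[m ->]; rewrite mulnK // => gm.
by rewrite mulnC dvdn_pmul2r //; apply: (dvdn_gcd_exp _ _).1 (dvdnn _) _ gm.
Qed.

Lemma comp_aff0 g (l : R) : g \Po aff l 0 = \poly_(j < size g) (l ^+ j * g`_j).
Proof.
rewrite comp_polyE poly_def; apply: eq_bigr => i _.
by rewrite /aff addr0 exprZn scalerA mulrC.
Qed.

Lemma coef_comp_aff0 g (l : R) j : (g \Po aff l 0)`_j = l ^+ j * g`_j.
Proof.
rewrite comp_aff0 coef_poly; case: ltnP => // sj.
by rewrite nth_default // mulr0.
Qed.

(** Write [h = x^m h1] with [h1(0) != 0]. The constant term of [h1] shows [c = l^m], so scaling by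
    [l] fixes [h1], and every exponent [j] of [h1] satisfies [l^j = 1], that is, [n] divides [j]. *)
Lemma scaled_poly n (l c : R) h : n.-primitive_root l -> h != 0 ->
  h \Po aff l 0 = c *: h ->
  exists i g, h = 'X^i * (g \Po 'X^n) /\ g.[0] != 0.
Proof.
move=> pl h0 E; have n0 := prim_order_gt0 pl.
have [m [h1 /implyP/(_ h0) h10 Eh]] := multiplicity_XsubC h 0.
move: Eh; rewrite subr0 mulrC => Eh.
have E1 : h1 \Po aff l 0 = h1.
  move/polyP: E => E.
  have hm j : h`_(m + j) = h1`_j by rewrite Eh coefXnM ltnNge leq_addr /= addKn.
  have c1 j : l ^+ m * l ^+ j * h1`_j = c * h1`_j.
    by rewrite -exprD -hm -coef_comp_aff0 E coefZ.
  have h00 : h1`_0 != 0 by rewrite -horner_coef0.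
  have Ec : c = l ^+ m.
    by apply: (mulIf h00); rewrite -c1 expr0 mulr1.
  apply/polyP => j; rewrite coef_comp_aff0.
  have lm : l ^+ m != 0.
    by rewrite expf_neq0 // (prim_root_neq0 pl).
  by apply: (mulfI lm); rewrite mulrA c1 Ec.
have := comp_Xn_decomp n0 (f := h1) _; set g := \poly_(_ < _) _ => D.
have {}D : h1 = g \Po 'X^n.
  apply: D => j hj; move/polyP/(_ j): E1; rewrite coef_comp_aff0.
  by rewrite -[RHS]mul1r => /(mulIf hj)/eqP; rewrite -(prim_order_dvd pl).
exists m, g; rewrite -D; split=> //.
by move: h10; rewrite /root D horner_comp !hornerE expr0n gtn_eqF.
Qed.

End ExponentGcd.

(** * The subspace polynomial [f_V(x - nu)] and the polynomials with periods in [V] *)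

Section SubspacePolynomial.
Variable K : closedFieldType.
Variable p : nat.
Hypothesis chp : p \in [pchar K].
Variable V : {fset K}.
Hypothesis V_subspace : Fp_subspace chp V.
Implicit Types (f h : {poly K}) (a nu v w : K).

Lemma subspace0 : 0 \in V.
Proof. by case: V_subspace. Qed.

Lemma subspaceD v w : v \in V -> w \in V -> v + w \in V.
Proof.
by case: V_subspace => _ L vV wV; have := L 1 v w vV wV; rewrite scale1r.
Qed.

Lemma subspaceN v : v \in V -> - v \in V.
Proof.
case: V_subspace => V0 L vV.
by have := L (-1) v 0 vV V0; rewrite scaleN1r addr0.
Qed.

Lemma subspaceB v w : v \in V -> w \in V -> v - w \in V.
Proof. by move=> vV /subspaceN; exact: subspaceD. Qed.

Lemma fV_atE nu : fV_at V nu = fV V \Po aff 1 (- nu).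
Proof. by rewrite /fV_at /aff scale1r polyCN. Qed.

Lemma fV_at_prod nu :
  fV_at V nu = \prod_(z <- [seq v + nu | v <- V]) ('X - z%:P).
Proof.
by rewrite fV_atE prod_XsubC_shift; under eq_map do rewrite opprK.
Qed.

Lemma fV_at_monic nu : fV_at V nu \is monic.
Proof. by rewrite fV_at_prod monic_prod_XsubC. Qed.

Lemma size_fV_at nu : size (fV_at V nu) = (size V).+1.
Proof. by rewrite fV_at_prod size_prod_XsubC size_map. Qed.

Lemma size_subspace_gt0 : (0 < size V)%N.
Proof. by have : 0 \in enum_fset V := subspace0; case: (enum_fset V). Qed.

Lemma size_fV_at_gt1 nu : (1 < size (fV_at V nu))%N.
Proof. by rewrite size_fV_at ltnS size_subspace_gt0. Qed.

Lemma root_fV_at nu a : root (fV_at V nu) a = (a - nu \in V).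
Proof.
rewrite fV_at_prod root_prod_XsubC; apply/mapP/idP => [[v vV ->]|aV].
  by rewrite addrK.
by exists (a - nu); rewrite ?subrK.
Qed.

Lemma horner_fV_at nu : (fV_at V nu).[nu] = 0.
Proof.
by apply/eqP; rewrite -[_ == _]/(root _ nu) root_fV_at subrr subspace0.
Qed.

Lemma fV_at_shift nu v : v \in V -> fV_at V (nu + v) = fV_at V nu.
Proof.
move=> vV; rewrite !fV_at_prod; apply/perm_big/uniq_perm.
- by rewrite map_inj_uniq ?fset_uniq //; exact: addIr.
- by rewrite map_inj_uniq ?fset_uniq //; exact: addIr.
move=> x; rewrite -!root_prod_XsubC -!fV_at_prod !root_fV_at opprD addrA.
apply/idP/idP => [/subspaceD/(_ vV)|/subspaceB/(_ vV)//].
by rewrite subrK.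
Qed.

Lemma fV_at_period nu v : v \in V -> period (fV_at V nu) v.
Proof.
move=> vV; rewrite /period -[RHS](fV_at_shift nu (subspaceN vV)) !fV_atE.
by rewrite -comp_polyA comp_aff !mul1r opprB.
Qed.

(** After moving [nu] to [0], scaling by [a] multiplies [f_V] by [a ^+ size V], which equals [a] by
    [expr_size_stable]. *)
Lemma fV_at_scale nu a : a != 0 -> (forall v, v \in V -> a * v \in V) ->
  fV_at V nu \Po aff a ((1 - a) * nu) = a *: fV_at V nu.
Proof.
move=> a0 aV; rewrite !fV_atE -comp_polyA comp_aff !mul1r.
have -> : aff a ((1 - a) * nu - nu) = aff a 0 \Po aff 1 (- nu).
  by rewrite comp_aff mulr1; congr aff; ring.
rewrite comp_polyA (prod_XsubC_scale (fset_uniq V) a0 aV).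
by rewrite (expr_size_stable (fset_uniq V) subspace0 aV) comp_polyZ.
Qed.

Lemma comp_scale h nu a : a != 0 -> (forall v, v \in V -> a * v \in V) ->
  (h \Po fV_at V nu) \Po aff a ((1 - a) * nu) = (h \Po aff a 0) \Po fV_at V nu.
Proof.
move=> a0 aV; rewrite -comp_polyA fV_at_scale // -[RHS]comp_polyA.
congr (_ \Po _).
by rewrite /aff addr0 comp_polyZ comp_polyX.
Qed.

(** Induction on the degree: [f - f(nu)] vanishes on [nu + V], hence is a multiple of [f_V(x - nu)],
    and the quotient has smaller size and again all periods in [V]. *)
Lemma period_comp f nu : (forall v, v \in V -> period f v) ->
  exists h, f = h \Po fV_at V nu.
Proof.
elim: {f}(size f) {-2}f (leqnn (size f)) => [|n IH] f sf fP.
  by exists 0; rewrite comp_poly0; apply/eqP; rewrite -size_poly_leq0.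
set U := fV_at V nu; pose c := f.[nu].
have Udvd : (U %| f - c%:P)%R.
  rewrite /U fV_at_prod; apply: uniq_roots_dvdp.
    apply/allP => _ /mapP[v vV ->]; rewrite /root !hornerE subr_eq0 /c.
    by rewrite -[in eqbRHS](fP v vV) horner_comp /aff !hornerE addrC.
  rewrite uniq_rootsE map_inj_uniq ?fset_uniq //; exact: addIr.
have [q Eq] := dvdpP _ _ Udvd.
have U0 : U != 0 by rewrite monic_neq0 ?fV_at_monic.
have {}Eq : f = q * U + c%:P by rewrite -Eq subrK.
have [h Eh] : exists h, q = h \Po U.
  apply: IH => [|v vV].
    have [->|q0] := eqVneq q 0; first by rewrite size_poly0.
    have s1 : (0 < size q)%N by rewrite size_poly_gt0.
    have sqU : size (q * U) = (size q + size V)%N.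
      by rewrite size_mul // size_fV_at addnS.
    have V1 := size_subspace_gt0.
    have sfE : size f = (size q + size V)%N.
      rewrite [in LHS]Eq size_polyDl sqU //.
      exact: leq_ltn_trans (size_polyC_leq1 _) (leq_add s1 V1).
    by rewrite -ltnS (leq_trans _ sf) // sfE -[X in (X < _)%N]addn0 ltn_add2l.
  have := fP v vV; rewrite /period {1}Eq comp_polyD comp_polyM comp_polyC.
  rewrite (fV_at_period _ vV) -/U [RHS]Eq => /addIr/(mulIf U0).
  by [].
exists (h * 'X + c%:P).
by rewrite Eq Eh comp_polyD comp_polyM comp_polyX comp_polyC.
Qed.

End SubspacePolynomial.

(** * Injectivity of Frobenius powers and existence of primitive roots of unity *)

Lemma expr_pchar_inj (R : idomainType) p s : p \in [pchar R] ->
  injective (fun x : R => x ^+ (p ^ s)).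
Proof.
move=> chp x y /= E; apply/eqP; rewrite -subr_eq0; apply/eqP.
have ps : [pchar R].-nat (p ^ s)%N.
  by rewrite pnatX pnatE ?chp // (pcharf_prime chp).
have := exprDn_pchar (x - y) y ps; rewrite subrK E => /eqP.
rewrite -[X in X == _]add0r => /eqP/addIr/esym/eqP; rewrite expf_eq0.
by move=> /andP[_ /eqP].
Qed.

(** As [n] is invertible in [K], [x^n - 1] is separable and has [n] distinct roots, enough for one
    of them to be primitive. *)
Lemma closed_prim_root (K : closedFieldType) n : (n%:R : K) != 0 ->
  exists z : K, n.-primitive_root z.
Proof.
move=> nK; have n0 : (0 < n)%N by case: n nK => //; rewrite eqxx.
have [r Er] := monic_splits (monicXnsubC (1 : K) n0).
have ur : uniq r.
  rewrite -separable_prod_XsubC -Er polyC1.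
  exact: separable_Xn_sub_1.
have ar : all n.-unity_root r.
  apply/allP => x xr; rewrite unity_rootE -subr_eq0.
  have : root ('X^n - 1%:P) x by rewrite Er root_prod_XsubC.
  by rewrite /root !hornerE.
have sr : size r = n.
  by apply/succn_inj; rewrite -(size_prod_XsubC r id) -Er size_XnsubC.
have := has_prim_root n0 ar ur; rewrite sr leqnn => /(_ isT)/hasP[z _ pz].
by exists z.
Qed.

(** * Statement 1 and the semidirect decomposition in terms of affine maps *)

Section EigengroupStructure.
Variable K : closedFieldType.
Variable p : nat.
Hypothesis chp : p \in [pchar K].
Variable f : {poly K}.
Hypothesis f_monic : f \is monic.
Hypothesis f_roots : exists a b : K, [/\ a != b, root f a & root f b].
Variable V : {fset K}.
Hypothesis V_subspace : Fp_subspace chp V.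
Hypothesis V_neq0 : exists2 v : K, v \in V & v != 0.
Variable e : nat.
Hypothesis e_mult : is_multiplier_field p V e.
Implicit Types (g h : {poly K}) (a b l nu v w : K) (n i j k : nat).

(* Statement 1 read on affine maps. *)
Definition core n l nu : Prop :=
  [/\ n.-primitive_root l, l != 1, forall w, period f w <-> w \in V,
      eig f l ((1 - l) * nu) & forall a b, eig f a b -> exists k, a = l ^+ k].

Lemma eig_stable a b v : (forall w, period f w <-> w \in V) ->
  eig f a b -> v \in V -> a * v \in V.
Proof. by move=> fV /(period_eig v f_monic) E /fV/E/fV. Qed.

Lemma eigengroup_shiftE :
  eigengroup_shift f = ShV V <-> forall w, period f w <-> w \in V.
Proof.
split=> [E w|E].
  have -> : period f w <-> eigengroup_shift f (sigma 1 w).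
    rewrite eigengroup_shift_sigma //; split=> [P|[w' /sigma_inj[_ ->]] //].
    by exists w.
  rewrite E; split=> [[v vV /sigma_inj[_ ->]] //|wV]; by exists w.
apply/seteqP; split=> s.
  by move/(eigengroup_shift_sigma _ f_monic) => [w -> /E wV]; exists w.
by move=> [v /E P ->]; apply/eigengroup_shift_sigma => //; exists v.
Qed.

Lemma core_complement n l nu : core n l nu ->
  is_eigengroup_complement f (cyclicAut (sigma l ((1 - l) * nu))).
Proof.
move=> [pl l1 fV E C]; have SE := eigengroup_shiftE.2 fV.
have lk0 k : l ^+ k != 0 by rewrite expf_neq0 // (prim_root_neq0 pl).
split.
- move=> s /eigengroupP[[a b] /= -> Ea]; have [a0 _] := Ea.
  rewrite SE; apply/seteqP; split=> _ [_ [v vV ->] <-].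
    (* Composing with [sigma a b] on the other side multiplies the translation by [a], so [v] must
       be divided by [a]. *)
    exists (sigma 1 (v / a)); last first.
      by rewrite !sigma_comp mulr1 !mul1r mulrCA mulfV // mulr1 addrC.
    exists (v / a) => //; apply/fV/(period_eig _ f_monic Ea)/fV.
    by rewrite mulrC divfK.
  exists (sigma 1 (a * v)).
    by exists (a * v); rewrite ?(eig_stable fV Ea).
  by rewrite !sigma_comp mulr1 !mul1r addrC.
- apply/seteqP; split=> s.
    move/eigengroupP => [[a b] /= -> Eab].
    have [k ak] := C _ _ Eab; rewrite {a}ak in Eab *.
    have Ek := eig_iter k E.
    (* The eigen-map and the rotation about [nu] have the same linear part [l ^+ k]; their constant
       terms differ by a period, rescaled here because of the order of composition. *)
    exists (sigma 1 ((b - (1 - l ^+ k) * nu) / l ^+ k)); last first.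
      exists (sigma (l ^+ k) ((1 - l ^+ k) * nu)).
        by apply/(cyclicAutP _ _ pl); exists k.
      by rewrite sigma_comp mulr1 mulrC divfK // subrK.
    rewrite SE; exists ((b - (1 - l ^+ k) * nu) / l ^+ k) => //.
    apply/fV/(period_eig _ f_monic Ek); rewrite mulrC divfK //.
    exact: period_diff Eab Ek.
  rewrite SE => -[_ [v /fV P ->]] [t /(cyclicAutP _ _ pl)[k ->] <-].
  rewrite sigma_comp mulr1; apply/eigengroup_sigma.
  have := eigM (eig_iter k E) ((eig1 v f_monic).2 P).
  by rewrite mulr1.
- apply/seteqP; split=> s; rewrite SE.
    move=> [[v vV ->] /(cyclicAutP _ _ pl)[k /sigma_inj[<- ->]]].
    by rewrite subrr mul0r sigma1.
  move=> ->; split.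
    by exists 0; rewrite ?sigma1 // (subspace0 V_subspace).
  by exists 0%N; left.
Qed.

Lemma statement1_atP n l nu : statement1_at f V n l nu <-> core n l nu.
Proof.
split=> [[/eigengroup_shiftE fV _ pl [_ G _] ntr]|c]; last first.
  have [pl l1 fV _ _] := c; split=> //.
  - exact/eigengroup_shiftE.
  - have [v vV v0] := V_neq0; move/seteqP => [/(_ (sigma 1 v)) S _].
    have : sigma 1 v = sigma 1 0 by rewrite sigma1; apply: S; exists v.
    by move=> /sigma_inj[_ /eqP]; rewrite (negPf v0).
  - exact: core_complement c.
  - move/seteqP => [/(_ (sigma l ((1 - l) * nu))) S _].
    have : sigma l ((1 - l) * nu) = sigma 1 0.
      by rewrite sigma1; apply: S; exists 1%N; left.
    by move=> /sigma_inj[/eqP]; rewrite (negPf l1).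
(* The product decomposition of the eigengroup, read off on the two coefficients. *)
have G' a b : eig f a b <-> exists2 v, v \in V &
    exists k, a = l ^+ k /\ b = l ^+ k * v + (1 - l ^+ k) * nu.
  rewrite -eigengroup_sigma G eigengroup_shiftE.2 //; split.
    move=> [_ [v vV ->]] [_ /(cyclicAutP _ _ pl)[k ->]].
    by rewrite sigma_comp mulr1 => /sigma_inj[<- <-]; exists v => //; exists k.
  move=> [v vV [k [-> ->]]]; exists (sigma 1 v); first by exists v.
  exists (sigma (l ^+ k) ((1 - l ^+ k) * nu)).
    by apply/(cyclicAutP _ _ pl); exists k.
  by rewrite sigma_comp mulr1.
split=> //; first 1 last.
- apply/G'; exists 0; first exact: subspace0 V_subspace.
  by exists 1%N; rewrite expr1 mulr0 add0r.
- by move=> a b /G'[v _ [k [-> _]]]; exists k.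
apply/eqP => l1; apply: ntr; apply/seteqP; split=> s.
  move=> /(cyclicAutP _ _ pl)[k ->].
  by rewrite l1 expr1n subrr mul0r sigma1.
by move=> ->; exists 0%N; left.
Qed.

End EigengroupStructure.

(** * Normal forms of [f] about a centre [nu], and the rigidity of [g] *)

Section NormalForm.
Variable K : closedFieldType.
Variable p : nat.
Hypothesis chp : p \in [pchar K].
Variable f : {poly K}.
Hypothesis f_monic : f \is monic.
Hypothesis f_roots : exists a b : K, [/\ a != b, root f a & root f b].
Variable V : {fset K}.
Hypothesis V_subspace : Fp_subspace chp V.
Hypothesis V_neq0 : exists2 v : K, v \in V & v != 0.
Variable e : nat.
Hypothesis e_mult : is_multiplier_field p V e.
Implicit Types (g h : {poly K}) (a b l nu v w : K) (n i j k : nat).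

Local Notation U := (fV_at V).

Definition normal_form n nu i g : Prop :=
  [/\ f = U nu ^+ i * (g \Po U nu ^+ n), g \is monic & g.[0] != 0].

(* For [g = 1] this says [n = p ^ e - 1], so that both cases of statement 2 are
   instances of the same condition. *)
Definition rigid n g : Prop :=
  forall k, (k %| (p ^ e).-1 %/ n)%N -> (forall j, g`_j != 0 -> (k %| j)%N) ->
  k = 1%N.

Lemma pe_gt1 : (1 < p ^ e)%N.
Proof.
have [e0 _ _] := e_mult.
by rewrite -[1%N](expn0 p) ltn_exp2l // prime_gt1 // (pcharf_prime chp).
Qed.

Lemma pe1_gt0 : (0 < (p ^ e).-1)%N.
Proof. by rewrite -ltnS prednK ?pe_gt1 // ltnW ?pe_gt1. Qed.

Lemma pe1_neq0 : ((p ^ e).-1%:R : K) != 0.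
Proof.
have [e0 _ _] := e_mult.
rewrite -subn1 natrB; last by rewrite ltnW ?pe_gt1.
rewrite natrX (pcharf0 chp) expr0n (gtn_eqF e0) sub0r oppr_eq0.
exact: oner_neq0.
Qed.

Lemma root_data_Fq n l : root_data V n l ->
  l \in Fq (p ^ e) /\ (n %| (p ^ e).-1)%N.
Proof.
move=> [pl _ lV]; have lF := multiplier_Fq V_subspace V_neq0 e_mult lV.
split=> //; rewrite (prim_order_dvd pl).
by rewrite (Fq_expr1 chp lF) ?eqxx // (prim_root_neq0 pl).
Qed.

Lemma prim_root_Fq n l : (n %| (p ^ e).-1)%N -> n.-primitive_root l ->
  l \in Fq (p ^ e).
Proof.
rewrite unfold_in => + pl; rewrite (prim_order_dvd pl) => /eqP E.
by rewrite -(prednK (ltnW pe_gt1)) exprS E mulr1.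
Qed.

Lemma Fq_stable a v : a \in Fq (p ^ e) -> v \in V -> a * v \in V.
Proof. by case: e_mult => _ S _; exact: S. Qed.

Lemma size_fV_at_exp_gt1 nu n : (0 < n)%N -> (1 < size (U nu ^+ n))%N.
Proof.
move=> n0; have U1 := size_fV_at_gt1 V_subspace nu.
have U0 : U nu != 0 by rewrite monic_neq0 ?fV_at_monic.
rewrite -ltnS -(prednK (_ : 0 < size (U nu ^+ n))%N).
  2: by rewrite size_poly_gt0 expf_neq0.
rewrite !ltnS size_exp muln_gt0 n0 andbT.
by case: (size _) U1 => [|[]].
Qed.

Lemma normal_form_comp n nu i g :
  U nu ^+ i * (g \Po U nu ^+ n) = ('X^i * (g \Po 'X^n)) \Po U nu.
Proof. by rewrite comp_polyM comp_Xn_poly -comp_polyA comp_Xn_poly. Qed.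

(** The rotation by [a] about [nu] multiplies [f_V(x - nu)] by [a], hence scales the variable of [g]
    by [a ^+ n]. *)
Lemma normal_form_scale n nu i g a :
  a != 0 -> (forall v, v \in V -> a * v \in V) ->
  (U nu ^+ i * (g \Po U nu ^+ n)) \Po aff a ((1 - a) * nu)
    = a ^+ i *: (U nu ^+ i * ((g \Po aff (a ^+ n) 0) \Po U nu ^+ n)).
Proof.
move=> a0 aV; rewrite comp_polyM rmorphXn /= (fV_at_scale V_subspace) //.
rewrite exprZn -scalerAl -!comp_polyA rmorphXn /= (fV_at_scale V_subspace) //.
by rewrite exprZn /aff addr0 comp_polyZ comp_polyX.
Qed.

Lemma normal_form_eig n nu i g a : normal_form n nu i g ->
  a != 0 -> (forall v, v \in V -> a * v \in V) ->
  g \Po aff (a ^+ n) 0 = g -> f \Po aff a ((1 - a) * nu) = a ^+ i *: f.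
Proof.
by move=> [fE _ _] a0 aV gE; rewrite [in LHS]fE normal_form_scale // gE -fE.
Qed.

(** Because [g(0) != 0], the constant terms show that the multiplier is exactly [a ^+ i]; what
    remains is invariance of [g]. *)
Lemma normal_form_root n nu i g a : normal_form n nu i g -> (0 < n)%N ->
  eig f a ((1 - a) * nu) -> (forall v, v \in V -> a * v \in V) ->
  g \Po aff (a ^+ n) 0 = g.
Proof.
move=> [fE _ g0] n0 E aV; have [a0 _] := E; have := eig_exp f_monic E.
set c := a ^+ (size f).-1; rewrite [in LHS]fE normal_form_scale // fE.
rewrite [in RHS]scalerAr scalerAr.
have U0 : U nu != 0 by rewrite monic_neq0 ?fV_at_monic.
move/(mulfI (expf_neq0 i U0)); rewrite -!comp_polyZ.
move/(comp_polyI (size_fV_at_exp_gt1 nu n0)).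
rewrite comp_polyZ => /polyP gE.
have ai0 : a ^+ i != 0 by rewrite expf_neq0.
have cE : c = a ^+ i.
  rewrite horner_coef0 in g0; apply: (mulIf g0); rewrite -coefZ -gE.
  by rewrite coefZ coef_comp_aff0 expr0 mul1r.
by apply/polyP => j; apply: (mulfI ai0); have := gE j; rewrite !coefZ cE.
Qed.

Lemma comp_aff0_fix g l : g \Po aff l 0 = g <->
  forall j, g`_j != 0 -> l ^+ j = 1.
Proof.
split=> [E j gj|E].
  by apply: (mulIf gj); rewrite -coef_comp_aff0 E mul1r.
apply/polyP => j; rewrite coef_comp_aff0.
by have [->|/E->] := eqVneq g`_j 0; rewrite ?mulr0 ?mul1r.
Qed.

Lemma normal_form_unique n nu i i' g g' : (0 < n)%N ->
  normal_form n nu i g -> normal_form n nu i' g' -> i = i' /\ g = g'.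
Proof.
move=> n0; wlog le : i i' g g' / (i <= i')%N.
  move=> H N N'; case: (leqP i i') => [le|/ltnW le]; first exact: H.
  by have [-> ->] := H _ _ _ _ le N' N.
move=> [fE _ g0] [fE' _ g0'].
have U0 : U nu != 0 by rewrite monic_neq0 ?fV_at_monic.
have : g \Po U nu ^+ n = U nu ^+ (i' - i) * (g' \Po U nu ^+ n).
  apply: (mulfI (expf_neq0 i U0)); rewrite mulrA -exprD subnKC //.
  by rewrite -fE.
have [->|ne] := eqVneq i i'.
  rewrite subnn mul1r => /(comp_polyI (size_fV_at_exp_gt1 nu n0)) ->.
  by [].
(* If [i < i'], evaluation at [nu], a root of [f_V(x - nu)], turns the right side into [0] and the
   left side into [g(0)]. *)
move/(congr1 (horner^~ nu)); rewrite hornerM !horner_comp !horner_exp.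
rewrite (horner_fV_at V_subspace) expr0n gtn_eqF // expr0n gtn_eqF.
  by rewrite mul0r => E; rewrite E eqxx in g0.
by rewrite subn_gt0 ltn_neqAle ne.
Qed.

Lemma core_root_data n l nu : core f V n l nu -> root_data V n l.
Proof.
by move=> [pl l1 fV E _]; split=> // v; exact: (eig_stable f_monic fV E).
Qed.

Lemma core_normal_form n l nu : core f V n l nu ->
  exists i g, normal_form n nu i g /\ rigid n g.
Proof.
move=> c; have rd := core_root_data c; have [lF ndvd] := root_data_Fq rd.
have [pl l1 fV E C] := c; have [_ _ lV] := rd; have n0 := prim_order_gt0 pl.
have l0 := prim_root_neq0 pl.
have U1 := size_fV_at_gt1 V_subspace nu.
have [h fE] := period_comp V_subspace nu (fun v => (fV v).2).
have h0 : h != 0.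
  by apply: contraNneq (monic_neq0 f_monic) => h0; rewrite fE h0 comp_poly0.
have hs : h \Po aff l 0 = l ^+ (size f).-1 *: h.
  apply: (comp_polyI U1); rewrite comp_polyZ -fE -(eig_exp f_monic E).
  by rewrite -(comp_scale V_subspace) // -fE.
have [i [g [hE g0]]] := scaled_poly pl h0 hs.
have nf : normal_form n nu i g.
  have fE' : f = U nu ^+ i * (g \Po U nu ^+ n).
    by rewrite normal_form_comp -hE.
  split=> //; have := f_monic; rewrite {1}fE' monicE lead_coefM lead_coef_exp.
  rewrite (monicP (fV_at_monic _ _)) expr1n mul1r lead_coef_comp.
    by rewrite lead_coef_exp (monicP (fV_at_monic _ _)) !expr1n mulr1.
  exact: size_fV_at_exp_gt1.
exists i, g; split=> // k kd kg.
(* A primitive root [z] of order [n k] then lies in the multiplier field, and [z ^+ n] fixes [g]. So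
   [z] gives an eigen-map and is a power of [l]; then [z ^+ n = 1], whence [k = 1]. *)
have nk : (n * k %| (p ^ e).-1)%N.
  by move: kd; rewrite -(dvdn_pmul2l n0) [X in (_ %| X)%N]mulnC divnK.
have nkK : ((n * k)%:R : K) != 0.
  apply: contraNneq pe1_neq0 => E0; case/dvdnP: nk => m ->.
  by rewrite natrM E0 mulr0.
have [z pz] := closed_prim_root nkK.
have zF := prim_root_Fq nk pz; have z0 := prim_root_neq0 pz.
have zV v := @Fq_stable z v zF.
have [|j zE] := C z ((1 - z) * nu).
  split=> //; exists (z ^+ i); first by rewrite expf_neq0.
  apply: (normal_form_eig nf) => //; apply/comp_aff0_fix => j /kg /dvdnP[m ->].
  by rewrite mulnC -exprM mulnA exprM (prim_expr_order pz) expr1n.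
have zn : z ^+ n = 1.
  by rewrite zE -exprM mulnC exprM (prim_expr_order pl) expr1n.
have := prim_order_dvd pz n; rewrite zn eqxx -{2}[n]muln1 dvdn_pmul2l // dvdn1.
by move=> /eqP.
Qed.

Lemma normal_form_core n l nu i g : root_data V n l -> normal_form n nu i g ->
  rigid n g -> (forall w, period f w -> w \in V) -> core f V n l nu.
Proof.
move=> rd nf rg fV'; have [lF ndvd] := root_data_Fq rd.
have [pl l1 lV] := rd; have n0 := prim_order_gt0 pl.
have l0 := prim_root_neq0 pl.
have fV w : period f w <-> w \in V.
  split=> [|wV]; first exact: fV'.
  have [-> _ _] := nf.
  by rewrite normal_form_comp /period -comp_polyA (fV_at_period V_subspace).
have El : eig f l ((1 - l) * nu).
  split=> //; exists (l ^+ i); first by rewrite expf_neq0.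
  apply: (normal_form_eig nf) => //; rewrite (prim_expr_order pl).
  by rewrite aff1 comp_polyXr.
split=> // a b E.
have aV v : v \in V -> a * v \in V by exact: (eig_stable f_monic fV E).
have aF := multiplier_Fq V_subspace V_neq0 e_mult aV.
have [a0 _] := E.
(* [a] and [l] commute, so the two composites of the corresponding affine maps
   differ by a translation; hence [a] fixes [nu] modulo [V]. *)
have bV : b - (1 - a) * nu \in V.
  have : period f ((a * ((1 - l) * nu) + b) - (l * b + (1 - l) * nu)).
    by apply: (period_diff f_monic (eigM E El)); rewrite mulrC; exact: eigM.
  have -> : (a * ((1 - l) * nu) + b) - (l * b + (1 - l) * nu)
     = (1 - l) * (b - (1 - a) * nu) by ring.
  have l1' : 1 - l != 0 by rewrite subr_eq0 eq_sym.
  move/fV/(Fq_stable (FqV (FqB chp (Fq1 K p e) lF))).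
  by rewrite mulKf.
have Ea : eig f a ((1 - a) * nu).
  have := eig_period f_monic E (periodN ((fV _).2 bV)).
  by rewrite opprB addrC subrK.
have /comp_aff0_fix ga := normal_form_root nf n0 Ea aV.
have anX : (a ^+ n) ^+ ((p ^ e).-1 %/ n) = 1.
  by rewrite -exprM mulnC divnK // (Fq_expr1 chp aF).
(* The order [k] of [a ^+ n] divides both [(p ^ e - 1) / n] and all exponents of [g], so rigidity
   makes it [1]. *)
have [|k pk kd] := prim_order_exists _ anX.
  by rewrite divn_gt0 // dvdn_leq // pe1_gt0.
have k1 : k = 1%N.
  by apply: rg => // j /ga gj; rewrite (prim_order_dvd pk) gj.
have an1 : a ^+ n = 1 by rewrite -(prim_expr_order pk) k1 expr1.
by have [j ->] := prim_rootP pl an1; exists j.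
Qed.

(** Each of [l], [l'] is a power of the other, so the orders agree. The two rotations with linear
    part [l] differ by the translation [(1 - l) * (nu' - nu)], and [1 - l] is an invertible
    multiplier of [V]. *)
Lemma core_unique n n' l l' nu nu' : core f V n l nu -> core f V n' l' nu' ->
  n = n' /\ nu' - nu \in V.
Proof.
move=> c c'.
have dv m m' r r' mu mu' : core f V m r mu -> core f V m' r' mu' -> (m %| m')%N.
  move=> [pr _ _ E _] [pr' _ _ _ C]; have [j rE] := C _ _ E.
  rewrite (prim_order_dvd pr) rE -exprM mulnC exprM (prim_expr_order pr').
  by rewrite expr1n.
split.
  apply/eqP; rewrite eqn_dvd (dv _ _ _ _ _ _ c c').
  exact: dv c' c.
have [lF _] := root_data_Fq (core_root_data c).
have [pl l1 fV E _] := c; have [_ _ _ E' C'] := c'.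
have [j lj] := C' _ _ E.
have := period_diff f_monic (eig_iter j E')
  (_ : eig f (l' ^+ j) ((1 - l) * nu)).
rewrite -lj => /(_ E)/fV; rewrite -mulrBr.
move/(Fq_stable (FqV (FqB chp (Fq1 K p e) lF))).
by rewrite mulKf // subr_eq0 eq_sym.
Qed.

End NormalForm.

(** Take [p ^ s]-th roots of the coefficients and divide the exponents by [p ^ s]; additivity of
    Frobenius reassembles [f]. *)
Lemma Frobenius_root (K : closedFieldType) p s (f : {poly K}) :
  p \in [pchar K] -> f \is monic -> (1 < size f)%N ->
  (forall j, f`_j != 0 -> (p ^ s %| j)%N) ->
  exists q, [/\ q \is monic, (1 < size q)%N & f = q ^+ (p ^ s)].
Proof.
move=> chp fm sf fs.
have P0 : (0 < p ^ s)%N by rewrite expn_gt0 prime_gt0 // (pcharf_prime chp).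
have chpP : p \in [pchar {poly K}] by rewrite pchar_poly.
have rt (x : K) : exists y, y ^+ (p ^ s) = x.
  have /closed_rootP[y] : size ('X^(p ^ s) - x%:P) != 1%N.
    by rewrite size_XnsubC // eqSS -lt0n.
  by rewrite /root !hornerE subr_eq0 => /eqP <-; exists y.
have [r rE] := choice rt.
have := comp_Xn_decomp P0 fs; set F := \poly_(_ < _) _ => fE.
pose q : {poly K} := \sum_(i < size F) r F`_i *: 'X^i.
have qE : f = q ^+ (p ^ s).
  have D : {morph (fun x : {poly K} => x ^+ (p ^ s)) : x y / x + y}.
    move=> x y; apply: exprDn_pchar.
    by rewrite pnatX pnatE ?chpP // (pcharf_prime chp).
  have Z : (0 : {poly K}) ^+ (p ^ s) = 0 by rewrite expr0n gtn_eqF.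
  rewrite /q (big_morph _ D Z) {1}fE comp_polyE; apply: eq_bigr => i _.
  by rewrite exprZn rE -!exprM mulnC.
have sq : (1 < size q)%N.
  rewrite ltnNge; apply: contraL sf => sq.
  by rewrite -leqNgt qE (size1_polyC sq) -rmorphXn size_polyC_leq1.
exists q; split=> //; apply/monicP/(@expr_pchar_inj _ p s chp) => /=.
by rewrite -lead_coef_exp -qE (monicP fm) expr1n.
Qed.

(** * Passage between the two cases of statement 2 and [core] *)

Section Cases.
Variable K : closedFieldType.
Variable p : nat.
Hypothesis chp : p \in [pchar K].
Variable f : {poly K}.
Hypothesis f_monic : f \is monic.
Hypothesis f_roots : exists a b : K, [/\ a != b, root f a & root f b].
Variable V : {fset K}.
Hypothesis V_subspace : Fp_subspace chp V.
Hypothesis V_neq0 : exists2 v : K, v \in V & v != 0.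
Variable e : nat.
Hypothesis e_mult : is_multiplier_field p V e.
Implicit Types (g h : {poly K}) (a b l nu v w : K) (n i j k : nat).

Lemma coprime_multiplier k : (k %| (p ^ e).-1)%N -> coprime k p.
Proof.
move=> kd; have [e0 _ _] := e_mult; apply: (coprime_dvdl kd).
rewrite -(coprime_pexpr _ _ e0) -[X in coprime _ X]prednK ?coprimenS //.
by rewrite ltnW // (pe_gt1 chp e_mult).
Qed.

(** A number prime to [p] divides the gcd of the exponents exactly when it divides its prime-to-[p]
    part. *)
Lemma dvdn_gcd_exp_p g k : (1 < size g)%N -> coprime k p ->
  (k %| gcd_exp_p p g)%N <-> (forall j, g`_j != 0 -> (k %| j)%N).
Proof.
move=> sg kp; rewrite -dvdn_gcd_exp -(partnC p (gcd_exp_gt0 sg)).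
by rewrite Gauss_dvdr // p_part coprimeXr.
Qed.

Lemma rigid_gcd n g : (n %| (p ^ e).-1)%N -> (1 < size g)%N ->
  rigid p e n g <-> gcdn ((p ^ e).-1 %/ n) (gcd_exp_p p g) = 1%N.
Proof.
move=> ndvd sg.
have cop k : (k %| (p ^ e).-1 %/ n)%N -> coprime k p.
  by move=> kd; apply/coprime_multiplier/(dvdn_trans kd)/dvdn_div.
split=> [R|E k kd kg].
  apply: R; first exact: dvdn_gcdl.
  by apply/(dvdn_gcd_exp_p sg); [exact/cop/dvdn_gcdl|exact: dvdn_gcdr].
apply/eqP; rewrite -dvdn1 -E dvdn_gcd kd /=.
by apply/(dvdn_gcd_exp_p sg); first exact: cop.
Qed.

Lemma rigid_one n : (n %| (p ^ e).-1)%N ->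
  rigid p e n (1 : {poly K}) <-> n = (p ^ e).-1.
Proof.
move=> ndvd; have pe0 := pe1_gt0 chp e_mult; split=> [R|->].
  (* The only exponent of [1] is [0], so rigidity applies to [k = (p ^ e - 1) / n] itself. *)
  rewrite -[RHS](divnK ndvd) (R _ (dvdnn _)) ?mul1n //.
  by move=> [|j]; rewrite ?dvdn0 // coef1 eqxx.
by move=> k; rewrite divnn pe0 dvdn1 => /eqP.
Qed.

Lemma first_caseP n nu i : first_case p e f V n nu i <->
  [/\ (1 <= i)%N, normal_form f V n nu i 1 & n = (p ^ e).-1].
Proof.
have E : fV_at V nu ^+ i * (1 \Po fV_at V nu ^+ n) = fV_at V nu ^+ i.
  by rewrite -[1]/(1%:P) comp_polyC mulr1.
rewrite /first_case /normal_form E; split=> [[i1 fE nE]|[i1 [fE _ _] nE]]//.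
by split=> //; rewrite monic1 hornerE oner_neq0.
Qed.

Lemma second_case_normal_form n l nu i g : second_case p e f V n l nu i g ->
  normal_form f V n nu i g.
Proof. by move=> [[fE gm _ g0] _]. Qed.

Lemma second_case_rigid n l nu i g : root_data V n l ->
  second_case p e f V n l nu i g -> rigid p e n g.
Proof.
move=> rd [[_ _ sg _] [_ E _]]; apply/rigid_gcd => //.
by have [] := root_data_Fq V_subspace V_neq0 e_mult rd.
Qed.

Lemma normal_form_sigma n l nu i g : root_data V n l ->
  normal_form f V n nu i g -> f \Po aff l ((1 - l) * nu) = l ^+ i *: f.
Proof.
move=> [pl _ lV] nf; apply: (normal_form_eig V_subspace nf) => //.
  exact: prim_root_neq0 pl.
by rewrite (prim_expr_order pl) aff1 comp_polyXr.
Qed.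

Lemma Fp_adjoin_period l b c w : l \in Fq (p ^ e) -> eig f l b ->
  Fp_adjoin l c -> period f w -> period f (c * w).
Proof.
move=> lF E lc; move: w.
(* Restricting to [Fq (p ^ e)] makes inverses of nonzero elements powers, so closure under products
   yields closure under division. *)
pose S : {pred K} :=
  [pred c | (c \in Fq (p ^ e)) &&
            `[< forall w, period f w -> period f (c * w) >]].
suff /andP[_ /asboolP] : c \in S by [].
apply: lc; last first.
  by rewrite inE lF; apply/asboolP => w /(period_eig w f_monic E).
have SM x y : x \in S -> y \in S -> x * y \in S.
  move=> /andP[xF /asboolP xP] /andP[yF /asboolP yP].
  rewrite inE FqM //; apply/asboolP => w /yP/xP.
  by rewrite mulrA.
have S1 : 1 \in S.
  by rewrite inE Fq1; apply/asboolP => w; rewrite mul1r.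
have SX x k : x \in S -> x ^+ k \in S.
  by move=> xS; elim: k => [|k IH]; rewrite ?expr0 // exprS SM.
split=> // x y xS yS.
  move: xS yS => /andP[xF /asboolP xP] /andP[yF /asboolP yP].
  rewrite inE (FqB chp) //; apply/asboolP => w Pw.
  by rewrite mulrBl; apply: periodD; [exact: xP|exact/periodN/yP].
apply: SM => //; have [->|y0] := eqVneq y 0.
  rewrite invr0 inE -{1}(subrr 1) (FqB chp) ?Fq1 //=.
  by apply/asboolP => w _; rewrite mul0r; exact: period0.
have -> : y^-1 = y ^+ (p ^ e).-1.-1.
  apply: (mulfI y0); rewrite mulfV // -exprS prednK ?(pe1_gt0 chp e_mult) //.
  by move/andP: yS => [yF _]; rewrite (Fq_expr1 chp yF).
exact: SX.
Qed.

(** The roots of [f] form the coset [nu + V], so a period must lie in [V]. *)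
Lemma first_case_core n l nu i : root_data V n l -> first_case p e f V n nu i ->
  core f V n l nu.
Proof.
move=> rd /[dup] fc /first_caseP[i1 nf nE].
have [_ ndvd] := root_data_Fq V_subspace V_neq0 e_mult rd.
apply: (normal_form_core f_monic V_subspace V_neq0 e_mult rd nf).
  exact/rigid_one.
move=> w P; have [_ fE _] := fc.
have R a : root f a = (a - nu \in V).
  by rewrite fE /root horner_exp expf_eq0 i1 -(root_fV_at V nu).
have : root f (nu + w).
  by apply: root_period; rewrite // R subrr (subspace0 V_subspace).
by rewrite R addrAC subrr add0r.
Qed.

(** A period [w] outside [V] would contradict (b) at the roots [a + w] and [a]: by
    [Fp_adjoin_period], all multiples of [w] by [F_p(l)] are periods too. *)
Lemma second_case_core n l nu i g : root_data V n l ->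
  second_case p e f V n l nu i g -> core f V n l nu.
Proof.
move=> rd sc; have nf := second_case_normal_form sc.
apply: (normal_form_core f_monic V_subspace V_neq0 e_mult rd nf).
  exact: second_case_rigid sc.
move=> w P; apply: contrapT => /negP wV.
have [lF _] := root_data_Fq V_subspace V_neq0 e_mult rd.
have [a [_ [_ ra _]]] := f_roots.
have [_ [_ _ H]] := sc; apply: (H (a + w) a) => //.
- exact: root_period.
- apply: contraNneq wV => /eqP; rewrite -subr_eq0 addrAC subrr add0r => /eqP ->.
  exact: subspace0 V_subspace.
- by rewrite addrAC subrr add0r.
rewrite addrAC subrr add0r => _ [c lc <-] b.
have [pl _ _] := rd.
have E : eig f l ((1 - l) * nu).
  split; first exact: prim_root_neq0 pl.
  exists (l ^+ i); last exact: normal_form_sigma rd nf.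
  by rewrite expf_neq0 // (prim_root_neq0 pl).
have := Fp_adjoin_period lF E lc P.
by move/(period_mupP _ f_monic)/(_ b) => ->.
Qed.

Lemma root_data_gt1 n l : root_data V n l -> (1 < n)%N.
Proof.
move=> [pl l1 _]; case: n pl => [|[|n]] pl //.
by have := prim_expr_order pl; rewrite expr1 => E; rewrite E eqxx in l1.
Qed.

Lemma core_statement2 n l nu : core f V n l nu -> statement2_at p e f V n l nu.
Proof.
move=> c; have rd := core_root_data f_monic c; split=> //.
have [_ ndvd] := root_data_Fq V_subspace V_neq0 e_mult rd.
have [i [g [nf rg]]] := core_normal_form f_monic V_subspace V_neq0 e_mult c.
have [sg|sg] := leqP (size g) 1.
  left; exists i; apply/first_caseP.
  have [fE gm g0] := nf.
  have g1 : g = 1.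
    rewrite (size1_polyC sg) -[1]/(1%:P); congr _%:P.
    move: gm; rewrite monicE lead_coefE; case: (size g) sg => [|[|]] //= _.
      by move/eqP.
    by move/eqP.
  subst g; split=> //; last exact/rigid_one.
  (* With [i = 0] and [g = 1], [f] would be [1] and have no root. *)
  rewrite lt0n; apply/eqP => i0; have [a [_ [_ ra _]]] := f_roots.
  move: ra; rewrite fE i0 expr0 mul1r -[1]/(1%:P) comp_polyC.
  by rewrite /root hornerC oner_eq0.
right; exists i, g; have [fE gm g0] := nf; split=> //; split.
- exact: root_data_gt1 rd.
- exact/rigid_gcd.
move=> a b ra rb ab abV H; move/negP: abV; apply.
have [_ _ fV _ _] := c; apply/fV.
apply: (stable_period chp f_monic); apply: H.
(* The scalar [1] lies in every subfield, so stability already makes [a - b] a period. *)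
by exists 1; rewrite ?mul1r // => S [].
Qed.

Lemma statement2_core n l nu : statement2_at p e f V n l nu -> core f V n l nu.
Proof.
move=> [rd [[i]|[i [g]]]]; first exact: first_case_core.
exact: second_case_core.
Qed.

End Cases.

(** * Uniqueness, invariance, the formula for [n] and the location of [nu] *)

Section Consequences.
Variable K : closedFieldType.
Variable p : nat.
Hypothesis chp : p \in [pchar K].
Variable f : {poly K}.
Hypothesis f_monic : f \is monic.
Hypothesis f_roots : exists a b : K, [/\ a != b, root f a & root f b].
Variable V : {fset K}.
Hypothesis V_subspace : Fp_subspace chp V.
Hypothesis V_neq0 : exists2 v : K, v \in V & v != 0.
Variable e : nat.
Hypothesis e_mult : is_multiplier_field p V e.
Implicit Types (g h : {poly K}) (a b l nu v w : K) (n i j k : nat).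

Lemma two_roots_size : (1 < size f)%N.
Proof.
have [a [_ [_ ra _]]] := f_roots.
exact: root_size_gt1 (monic_neq0 f_monic) ra.
Qed.

Lemma normal_forms_agree n n' l l' nu nu' i i' g g' :
  core f V n l nu -> core f V n' l' nu' ->
  normal_form f V n nu i g -> normal_form f V n' nu' i' g' ->
  [/\ n = n', i = i', g = g' & nu' - nu \in V].
Proof.
move=> c c' nf nf'.
have [nn nuV] := core_unique f_monic V_subspace V_neq0 e_mult c c'.
subst n'; have [pl _ _ _ _] := c.
have nf1 : normal_form f V n nu i' g'.
  have [fE gm g0] := nf'; split=> //.
  by rewrite -(fV_at_shift V_subspace nu nuV) addrC subrK.
have := normal_form_unique V_subspace (prim_order_gt0 pl) nf nf1.
by move=> [-> ->].
Qed.

Lemma normal_form_invariants n l nu i g : core f V n l nu ->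
  normal_form f V n nu i g ->
  sigma l ((1 - l) * nu) f = l ^+ i *: f /\
  (eigengroup_invariants f f <-> (n %| i)%N).
Proof.
move=> c nf; have rd := core_root_data f_monic c.
have E := normal_form_sigma V_subspace rd nf.
have [pl _ _ El C] := c; split=> //; rewrite (prim_order_dvd pl).
have f0 := monic_neq0 f_monic.
have fI a : a *: f = f -> a = 1.
  move/(congr1 lead_coef); rewrite lead_coefZ (monicP f_monic) mulr1.
  by [].
split=> [H|/eqP li].
  by apply/eqP/fI; rewrite -E; apply/H/eigengroup_sigma.
move=> s /eigengroupP[[a b] /= -> Eab]; rewrite sigmaE (eig_exp f_monic Eab).
have [k ->] := C _ _ Eab.
(* The rotation by [l] has multiplier both [l ^+ i] and [l] to the degree of [f]. *)
have ld : l ^+ (size f).-1 = 1.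
  by apply: fI; rewrite -(eig_exp f_monic El) E li scale1r.
by rewrite -exprM mulnC exprM ld expr1n scale1r.
Qed.

(** As [n] is prime to [p], [g(x^n)] has prime-to-[p] gcd [n] times that of [g]; factoring [n] out
    leaves the gcd in (a). *)
Lemma second_case_gcd n l nu i g : root_data V n l ->
  second_case p e f V n l nu i g ->
  n = gcdn (p ^ e).-1 (gcd_exp_p p (g \Po 'X^n)).
Proof.
move=> rd [[_ _ sg _] [_ E _]].
have [_ ndvd] := root_data_Fq V_subspace V_neq0 e_mult rd.
have [pl _ _] := rd; have n0 := prim_order_gt0 pl.
rewrite /gcd_exp_p gcd_exp_comp_Xn // partnM ?gcd_exp_gt0 //.
have np : p^'.-nat n.
  rewrite p'natE ?(pcharf_prime chp) // -prime_coprime ?(pcharf_prime chp) //.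
  by rewrite coprime_sym (coprime_multiplier chp e_mult).
rewrite part_pnat_id // -{1}(divnK ndvd) [(_ * n)%N]mulnC -muln_gcdr E.
by rewrite muln1.
Qed.

Lemma root_normal_form n nu i g : (0 < n)%N -> normal_form f V n nu i g ->
  (1 <= i)%N <-> root f nu.
Proof.
move=> n0 [-> _ g0]; rewrite /root hornerM horner_comp !horner_exp.
rewrite (horner_fV_at V_subspace) [0 ^+ n]expr0n gtn_eqF // mulf_eq0 (negPf g0).
by rewrite orbF expf_eq0 eqxx andbT.
Qed.

(** For [i = 0] the rotation fixes [f], hence fixes [f1] by injectivity of Frobenius. The chain rule
    at the fixed point [nu] gives [l f1'(nu) = f1'(nu)] with [l != 1]. *)
Lemma root_deriv_normal_form n l nu g f1 s : root_data V n l ->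
  normal_form f V n nu 0 g -> f = f1 ^+ (p ^ s) -> root f1^`() nu.
Proof.
move=> rd nf fE; have E := normal_form_sigma V_subspace rd nf.
have [_ l1 _] := rd.
have chpP : p \in [pchar {poly K}] by rewrite pchar_poly.
have E1 : f1 \Po aff l ((1 - l) * nu) = f1.
  apply: (expr_pchar_inj (s := s) chpP); rewrite /= -fE -rmorphXn -fE /=.
  by rewrite E expr0 scale1r.
have := congr1 (fun q => q^`().[nu]) E1.
rewrite /= deriv_comp hornerM horner_comp {2}/aff derivD derivZ derivX derivC.
rewrite addr0 alg_polyC hornerC /aff !hornerE.
have -> : l * nu + (1 - l) * nu = nu by ring.
move/eqP; rewrite -subr_eq0 -[X in _ - X]mulr1 -mulrBr mulf_eq0 subr_eq0.
by rewrite (negPf l1) orbF.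
Qed.

End Consequences.

Theorem theorem4p18 (K : closedFieldType) (p : nat) (chp : p \in [pchar K])
    (f : {poly K}) (f_monic : f \is monic)
    (f_roots : exists a b : K, [/\ a != b, root f a & root f b])
    (V : {fset K}) (V_subspace : Fp_subspace chp V)
    (V_neq0 : exists2 v : K, v \in V & v != 0)
    (e : nat) (e_mult : is_multiplier_field p V e) :
  exists2 f1 : {poly K},
    unique (fun q : {poly K} => [/\ q \is monic, (1 < size q)%N
                & f = q ^+ (p ^ logn p (gcd_exp f))]) f1
  & (* equivalence of the two statements, with the same n, lambda_n and nu *)
    ((statement1 f V <-> statement2 p e f V) /\
     (forall (n : nat) (l nu : K),
        statement1_at f V n l nu <-> statement2_at p e f V n l nu)) /\
    (* parenthetical remarks of statement 2 *)
    ((forall (n : nat) (l nu : K), statement2_at p e f V n l nu -> (2 <= n)%N)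
     /\
     (forall (n : nat) (l nu : K) (i : nat),
        root_data V n l -> first_case p e f V n nu i ->
        [/\ (p, e) <> (2%N, 1%N), eigengroup_shift f = ShV V,
            is_eigengroup_complement f (cyclicAut (sigma l ((1 - l) * nu)))
          & forall a : K, (a \in Fq (p ^ e)) && (a != 0) <->
                          exists k : nat, a = l ^+ k])) /\
    (* uniqueness, semi-invariance and invariance *)
    (statement1 f V ->
       [/\ forall (n n' : nat) (l l' nu nu' : K) (i i' : nat),
             root_data V n l -> root_data V n' l' ->
             first_case p e f V n nu i -> first_case p e f V n' nu' i' ->
             i = i' /\ nu' - nu \in V,
           forall (n n' : nat) (l l' nu nu' : K) (i i' : nat) (g g' : {poly K}),
             root_data V n l -> root_data V n' l' ->
             second_case p e f V n l nu i g ->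
             second_case p e f V n' l' nu' i' g' ->
             [/\ n = n', i = i', g = g' & nu' - nu \in V],
           forall (n n' : nat) (l l' nu nu' : K) (i i' : nat) (g : {poly K}),
             root_data V n l -> root_data V n' l' ->
             first_case p e f V n nu i ->
             ~ second_case p e f V n' l' nu' i' g,
           forall (n : nat) (l nu v : K) (i : nat) (g : {poly K}), v \in V ->
             root_data V n l ->
             [/\ fV_at V (nu + v) = fV_at V nu,
                 first_case p e f V n nu i -> first_case p e f V n (nu + v) i
               & second_case p e f V n l nu i g ->
                 second_case p e f V n l (nu + v) i g]
         & forall (n : nat) (l nu : K) (i : nat), root_data V n l ->
             first_case p e f V n nu i \/
             (exists g : {poly K}, second_case p e f V n l nu i g) ->
             sigma l ((1 - l) * nu) f = l ^+ i *: f /\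
             (eigengroup_invariants f f <-> (n %| i)%N)]) /\
    (* further properties in the second case *)
    (forall (n : nat) (l nu : K) (i : nat) (g : {poly K}),
       root_data V n l -> second_case p e f V n l nu i g ->
       (exists2 h : {poly K},
          unique (fun h' : {poly K} =>
                    f = fV_at V nu ^+ i * (h' \Po fV_at V nu)) h
        & h = g \Po 'X^n /\ n = gcdn (p ^ e).-1 (gcd_exp_p p h)) /\
       (((1 <= i)%N <-> root f nu) /\ (i = 0%N -> root f1^`() nu))).
Proof.
have sf := two_roots_size f_monic f_roots.
have chpP : p \in [pchar {poly K}] by rewrite pchar_poly.
have [f1 [f1m sf1 f1E]] : exists q, [/\ q \is monic, (1 < size q)%N
    & f = q ^+ (p ^ logn p (gcd_exp f))].
  apply: Frobenius_root => //; apply/dvdn_gcd_exp; exact: pfactor_dvdnn.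
(* Both statements are compared with [core] for the same [n], [l] and [nu]. *)
have coreP n l nu : core f V n l nu <-> statement2_at p e f V n l nu.
  by split=> [c|s]; [exact: core_statement2 c|exact: statement2_core s].
have st12 n l nu : statement1_at f V n l nu <-> statement2_at p e f V n l nu.
  by rewrite -coreP (statement1_atP f_monic V_subspace V_neq0).
have core1 n l nu i : root_data V n l -> first_case p e f V n nu i ->
    core f V n l nu.
  by move=> rd fc; apply/coreP; split=> //; left; exists i.
have core2 n l nu i g : root_data V n l -> second_case p e f V n l nu i g ->
    core f V n l nu.
  by move=> rd sc; apply/coreP; split=> //; right; exists i, g.
have nf1 n nu i : first_case p e f V n nu i -> normal_form f V n nu i 1.
  by case/first_caseP.
have nf2 n l nu i g : second_case p e f V n l nu i g ->
    normal_form f V n nu i g.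
  exact: second_case_normal_form.
have agree := normal_forms_agree f_monic V_subspace V_neq0 e_mult.
exists f1.
  split=> // q [_ _ qE].
  by apply: (expr_pchar_inj chpP); exact: etrans (esym f1E) qE.
split.
  split=> //; by split=> -[n [l [nu s]]]; exists n, l, nu; apply/st12.
split; [split|split].
- by move=> n l nu [rd _]; exact: root_data_gt1 rd.
- move=> n l nu i rd fc; have c := core1 _ _ _ _ rd fc.
  have [pl l1 fV _ _] := c; have n1 := root_data_gt1 rd.
  have [lF _] := root_data_Fq V_subspace V_neq0 e_mult rd.
  have [_ _ nE] := fc; split.
  (* For [p = 2] and [e = 1], [n] would be [1]. *)
  + by move=> -[pE eE]; move: n1; rewrite nE pE eE.
  + exact: (eigengroup_shiftE f_monic V).2 fV.
  + exact: (core_complement f_monic V_subspace c).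
  move=> a; split=> [/andP[aF a0]|[k ->]].
    have := Fq_expr1 chp aF a0; rewrite -nE => /(prim_rootP pl)[j ->].
    by exists j.
  rewrite expf_neq0 ?(prim_root_neq0 pl) // andbT.
  by move: lF; rewrite !unfold_in -exprM mulnC exprM => /eqP->.
- move=> _; split.
  + move=> n n' l l' nu nu' i i' rd rd' fc fc'.
    by have [] := agree _ _ _ _ _ _ _ _ _ _ (core1 _ _ _ _ rd fc)
      (core1 _ _ _ _ rd' fc') (nf1 _ _ _ fc) (nf1 _ _ _ fc').
  + move=> n n' l l' nu nu' i i' g g' rd rd' sc sc'.
    exact: agree (core2 _ _ _ _ _ rd sc) (core2 _ _ _ _ _ rd' sc')
      (nf2 _ _ _ _ _ sc) (nf2 _ _ _ _ _ sc').
  + move=> n n' l l' nu nu' i i' g rd rd' fc sc.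
    have [_ _ g1 _] := agree _ _ _ _ _ _ _ _ _ _ (core1 _ _ _ _ rd fc)
      (core2 _ _ _ _ _ rd' sc) (nf1 _ _ _ fc) (nf2 _ _ _ _ _ sc).
    (* Agreement of the normal forms would make the nonscalar [g] equal to [1]. *)
    by have [[_ _ + _] _] := sc; rewrite -g1 size_poly1.
  + move=> n l nu v i g vV _.
    have E := fV_at_shift V_subspace nu vV.
    by rewrite /first_case /second_case E.
  move=> n l nu i rd [fc|[g sc]].
    exact: (normal_form_invariants f_monic V_subspace
      (core1 _ _ _ _ rd fc) (nf1 _ _ _ fc)).
  exact: (normal_form_invariants f_monic V_subspace
    (core2 _ _ _ _ _ rd sc) (nf2 _ _ _ _ _ sc)).
move=> n l nu i g rd sc; have nf := nf2 _ _ _ _ _ sc.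
have n0 : (0 < n)%N := ltnW (root_data_gt1 rd).
split; last first.
  split; first exact: (root_normal_form V_subspace n0 nf).
  move=> i0; rewrite i0 in nf.
  exact: (root_deriv_normal_form V_subspace rd nf f1E).
exists (g \Po 'X^n); last first.
  by split=> //; exact: (second_case_gcd V_subspace V_neq0 e_mult rd sc).
have [fE _ _] := nf.
have hE : f = fV_at V nu ^+ i * ((g \Po 'X^n) \Po fV_at V nu).
  by rewrite -comp_polyA comp_Xn_poly.
split=> // h fE'.
have U0 : fV_at V nu != 0 by rewrite monic_neq0 ?fV_at_monic.
apply: (comp_polyI (size_fV_at_gt1 V_subspace nu)).
by apply: (mulfI (expf_neq0 i U0)); rewrite -hE.
Qed.
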